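(* For $1\le i\le d$ let $(Y_i,d_i)$ be a compact metric space supporting a $g_i$-Ahlfors regular measure $\mathcal H^{g_i}$, with $g_i$ a doubling dimension function. For each $i$ let $f_i$ be a dimension function with $f_i\preceq g_i$, and assume that for distinct $i,j$ either $f_ig_j\preceq f_jg_i$ or $f_jg_i\preceq f_ig_j$. Assume that for each $i$, $\{E_{n,i}\}_{n\ge1}$ is a sequence of open subsets of $Y_i$ with $\limsup_{n\to\infty}E_{n,i}\in\mathscr G^{f_i}(Y_i)$. Let $\tilde f_i=g_1\cdots g_{i-1}f_ig_{i+1}\cdots g_d$. Then for each $i$, $Y_1\times\cdots\times Y_{i-1}\times(\limsup_{n\to\infty}E_{n,i})\times Y_{i+1}\times\cdots\times Y_d\in\mathscr G^{\tilde f_i}(\prod_{j=1}^dY_j)$. In particular, if $1\le k\le d$ is such that $\tilde f_k\preceq\tilde f_i$ for all $i$, then $(\limsup_nE_{n,1})\times\cdots\times(\limsup_nE_{n,d})\in\mathscr G^{\tilde f_k}(\prod_{j=1}^dY_j)$.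
   Context: The product $\prod_jY_j$ carries the metric $\max_jd_j$. A dimension function is a continuous nondecreasing $f:\mathbb R^+\to\mathbb R^+$ with $f(0)=0$; doubling: $f(2r)<Df(r)$ for some $D>1$. $\mathcal H^f_\eta(A)=\inf\{\sum_if(|B_i|):A\subset\bigcup_iB_i,\ B_i\text{ balls},|B_i|\le\eta\}$, $\mathcal H^f=\lim_{\eta\to0}\mathcal H^f_\eta$, $\mathcal H^f_\infty$ the Hausdorff $f$-content. $g$-Ahlfors regular: $\mathcal H^g(B(x,r))\asymp g(r)$ for all $x,r$. $h\preceq f$: $r\mapsto h(r)/f(r)$ monotonic and $\lim_{r\to0}h(r)/f(r)>0$. For a metric space $Z$, $\mathscr G^f(Z)$ is the class of $G_\delta$ sets $A\subset Z$ for which there is $c>0$ with $\mathcal H^f_\infty(A\cap B)>c\,\mathcal H^f_\infty(B)$ for all balls $B\subset Z$. *)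

(* Defs.v *)
From HB Require Import structures.
From mathcomp Require Import all_boot all_order all_algebra.
From mathcomp Require Import all_classical all_reals all_analysis.
From mathcomp Require Import borel_hierarchy.

Set Implicit Arguments.
Unset Strict Implicit.
Unset Printing Implicit Defensive.
Import Order.TTheory GRing.Theory Num.Theory.
Import numFieldNormedType.Exports.

Local Open Scope classical_set_scope.
Local Open Scope ring_scope.

(* An alias of the dependent product, so that its topology is the one of the
   max metric below (the library equips [forall i, Y i] with no metric). *)
Definition max_product (R : realType) (d : nat) (Y : 'I_d -> metricType R) :=
  forall i, Y i.

Section MaxProduct.
Context (R : realType) (d : nat) (Y : 'I_d -> metricType R).

HB.instance Definition _ := gen_eqMixin (max_product Y).
HB.instance Definition _ := gen_choiceMixin (max_product Y).

Definition max_dist (x y : max_product Y) : R :=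
  \big[Num.max/0]_(i < d) mdist (x i) (y i).

Let max_distxx x : max_dist x x = 0.
Proof.
rewrite /max_dist; apply: (big_ind (fun t => t = 0)) => // [_ _ -> ->|i _].
  exact: maxxx.
exact: mdistxx.
Qed.

Let max_dist_positivity x y : max_dist x y = 0 -> x = y.
Proof.
move=> xy0; apply: functional_extensionality_dep => i.
apply: mdist_positivity; apply/eqP; rewrite eq_le mdist_ge0 andbT -xy0.
exact: (le_bigmax _ (fun i => mdist (x i) (y i))).
Qed.

Let max_dist_sym x y : max_dist x y = max_dist y x.
Proof. by apply: eq_bigr => i _; rewrite metric_sym. Qed.

Let max_dist_triangle y x z : max_dist x z <= max_dist x y + max_dist y z.
Proof.
apply/bigmax_leP; split=> [|i _].
  by rewrite addr_ge0//; apply: bigmax_ge_id.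
apply: (le_trans (metric_triangle _ (y i) _)); apply: lerD.
  exact: (le_bigmax _ (fun i => mdist (x i) (y i))).
exact: (le_bigmax _ (fun i => mdist (y i) (z i))).
Qed.

HB.instance Definition _ := isMetric.Build R (max_product Y)
  max_distxx max_dist_positivity max_dist_sym max_dist_triangle.

End MaxProduct.

Section DimensionFunctions.
Context (R : realType).
Implicit Types f g h : R -> R.

(* A function on [0, +oo[ is represented by a function on R whose values at
   negative arguments are irrelevant. *)
Definition dimension_function f :=
  [/\ {within `[0, +oo[, continuous f},
      (forall r s, 0 <= r -> r <= s -> f r <= f s),
      (forall r, 0 <= r -> 0 <= f r)
    & f 0 = 0].

(* The strict inequality can only be required for r > 0, since f 0 = 0. *)
Definition doubling f :=
  exists2 D : R, 1 < D & forall r, 0 < r -> f (2 * r) < D * f r.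

(* Monotonic means either nondecreasing or nonincreasing; the limit is taken
   in the extended reals and may be +oo. *)
Definition dim_preceq h f :=
  ((forall r s, 0 < r -> r <= s -> h r / f r <= h s / f s) \/
   (forall r s, 0 < r -> r <= s -> h s / f s <= h r / f r)) /\
  exists2 l : \bar R, (0 < l)%E & (h r / f r)%:E @[r --> 0^'+] --> l.

Definition dim_tilde (d : nat) (g f : 'I_d -> R -> R) (i : 'I_d) : R -> R :=
  fun r => f i r * \prod_(j < d | j != i) g j r.

End DimensionFunctions.

Section Hausdorff.
Context (R : realType) (Z : metricType R).
Implicit Types (A B : set Z) (f g : R -> R).

Definition is_ball B := exists x : Z, exists2 r : R, 0 < r & B = ball x r.

(* Only meaningful for bounded sets: [sup] is 0 on sets without upper bound.
   It is used for balls and for compact spaces. *)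
Definition diameter A : R :=
  sup [set t | exists x y, [/\ A x, A y & t = mdist x y]].

(* [D] makes the cover at most countable: finite, empty or infinite. *)
Definition ball_cover (eta : \bar R) A (D : set nat) (B : nat -> set Z) :=
  (forall i, D i -> is_ball (B i) /\ ((diameter (B i))%:E <= eta)%E) /\
  A `<=` \bigcup_(i in D) B i.

Definition hausdorff_eta f (eta : \bar R) A : \bar R :=
  ereal_inf [set t | exists (D : set nat) (B : nat -> set Z),
    ball_cover eta A D B /\ t = (\esum_(i in D) (f (diameter (B i)))%:E)%E].

Definition hausdorff_measure f A : \bar R :=
  lim (hausdorff_eta f eta%:E A @[eta --> (0 : R)^'+]).

Definition hausdorff_content f A : \bar R := hausdorff_eta f +oo%E A.

(* Radii are restricted to the scales of the space: for a bounded space and an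
   unbounded g such as a power function, no lower bound can hold at all r. *)
Definition ahlfors_regular g :=
  exists a b : R, [/\ 0 < a, 0 < b &
    forall (x : Z) (r : R), 0 < r -> r <= diameter [set: Z] ->
      ((a * g r)%:E <= hausdorff_measure g (ball x r) <= (b * g r)%:E)%E].

Definition large_intersection_class f : set (set Z) :=
  [set A | Gdelta A /\
    exists2 c : R, 0 < c & forall B, is_ball B ->
      (c%:E * hausdorff_content f B < hausdorff_content f (A `&` B))%E].

End Hausdorff.

(* Main.v *)
(* A content lower bound for U in every ball has a covering consequence: if balls
   B_i of finite total cost cover U in an open set O, then for every s > 1 the
   balls s B_i cover O up to a set of content zero.
   Let balls B_i of finite total cost cover, in O, the intersection of countably
   many such open sets U_n.  Choose a dilation factor t in ]1, 2[ outside a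
   countable set of critical values, and let K be the set of points of O none of
   whose neighbourhoods is covered by the t B_i up to a null set.  By the
   covering consequence each U_n is dense in K, so by Baire the intersection
   would meet K if K were nonempty; but it is covered by the B_i.  Hence the t B_i
   cover O up to a null set, and the intersection inherits a lower bound.
   For a single cylinder, a cover is integrated one coordinate at a time, where
   integration over Y_j is replaced by the weighted content, which the Vitali
   covering argument compares with the content.  Of Ahlfors regularity this uses
   only the resulting lower bound for the g_j-content of balls. *)

Require Import Defs.
From HB Require Import structures.
From mathcomp Require Import all_boot all_order all_algebra.
From mathcomp Require Import all_classical all_reals all_analysis.
From mathcomp Require Import finmap ring lra.

Set Implicit Arguments.
Unset Strict Implicit.
Unset Printing Implicit Defensive.
Import Order.TTheory GRing.Theory Num.Theory.
Import numFieldNormedType.Exports.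

Local Open Scope classical_set_scope.
Local Open Scope ring_scope.

(** * Extended sums *)

(** The open sets to be intersected are cylinders over the tails of the limsup sets, one for each
    coordinate and each starting index; a tail contains the limsup set, hence inherits its content
    bound. In the second claim the bound for coordinate i concerns the function of i, and the
    relation assumed between the products transfers it to the function of k. Content is not
    additive, so the losses of successive intersections cannot be estimated by subtraction. The
    covering consequence turns each loss into a null set, and null sets do add up. Its price is the
    factor s: applied to balls dilated by t it covers only with factor s t, never t again. Hence the
    choice of a t for which coverage by all larger factors implies coverage by t itself; each member
    of a countable base excludes a single value of t. Balls are measured by radii instead of
    diameters, because a radius can be dilated, and dimension functions are frozen beyond a bound
    for the diameter of the space, which makes them doubling at every scale. Both changes cost only
    constant factors. *)

Section ExtendedSums.
Context (R : realType).
Local Open Scope ereal_scope.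

Lemma esum_subset (T : choiceType) (A B : set T) (a : T -> \bar R) :
  A `<=` B -> \esum_(i in A) a i <= \esum_(i in B) a i.
Proof.
move=> AB; apply: ge_ereal_sup => _ [X [finX XA] <-]; apply: esum_ge.
by exists X => //; split=> // x /XA /AB.
Qed.

Lemma esum_bigcup_le (T : choiceType) (J : nat -> set T) (a : T -> \bar R) :
  (forall x, 0 <= a x) ->
  \esum_(i in \bigcup_k J k) a i <= \sum_(k <oo) \esum_(i in J k) a i.
Proof.
move=> a0; rewrite seqDU_bigcup_eq esum_bigcupT//.
rewrite -nneseries_esumT; last by move=> n; apply: esum_ge0.
by apply: lee_nneseries => [k _ _|k _]; [by apply: esum_ge0|
   apply: esum_subset; exact: subset_seqDU].
Qed.

Lemma esum_setU_le (T : choiceType) (A B : set T) (a : T -> \bar R) :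
  (forall x, 0 <= a x) ->
  \esum_(i in A `|` B) a i <= \esum_(i in A) a i + \esum_(i in B) a i.
Proof.
move=> a0; rewrite (esumID A)//; apply: leeD; apply: esum_subset => x [].
  by [].
by case.
Qed.

(** Repetitions collapse in an image, so the sum can only drop. It serves whenever an indexed family
    of balls is turned into a cover, since covers below are sets of pairs. *)
Lemma esum_image_le (T T' : choiceType) (P : set T) (e : T -> T')
    (a : T' -> \bar R) :
  \esum_(j in e @` P) a j <= \esum_(i in P) a (e i).
Proof.
have [->|/set0P[p0 Pp0]] := eqVneq P set0; first by rewrite image_set0 !esum_set0.
have /choice[h hP] : forall j, exists i, (e @` P) j -> P i /\ e i = j.
  move=> j; have [[i Pi ij]|nj] := pselect ((e @` P) j); first by exists i.
  by exists p0 => /nj.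
have hinj : set_inj (e @` P) h.
  by move=> x y /set_mem/hP[_ xE] /set_mem/hP[_ yE] hxy; rewrite -xE -yE hxy.
have -> : \esum_(j in e @` P) a j = \esum_(i in h @` (e @` P)) a (e i).
  by rewrite [RHS]esum_image//; apply: eq_esum => j /hP[_ ->].
by apply: esum_subset => _ [j jP <-]; have [] := hP _ jP.
Qed.

Lemma esum_pairwise_disjoint (U T : choiceType) (s : seq U) (J : U -> set T)
    (S : set T) (a : T -> \bar R) :
  (forall x, 0 <= a x) -> (forall u, u \in s -> J u `<=` S) ->
  pairwise (fun u v => `[< J u `&` J v = set0 >]) s ->
  \sum_(u <- s) \esum_(i in J u) a i <= \esum_(i in S) a i.
Proof.
move=> a0; elim: s S => [|u s IH] S JS; first by rewrite big_nil esum_ge0.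
rewrite big_cons /= => /andP[/allP us pws]; rewrite (esumID (J u) S)//.
apply: leeD; first by apply: esum_subset => i Ji; split=> //; apply: (JS u);
  rewrite ?mem_head.
apply: IH => // v vs i Ji; split; first by apply: (JS v) => //; rewrite inE vs orbT.
by move=> Jui; have /asboolP uv := us _ vs; rewrite -[False]/(set0 i) -uv.
Qed.

Lemma esum_seq_le (T : choiceType) (s : seq T) (a : T -> \bar R) :
  (forall x, 0 <= a x) ->
  \esum_(i in [set i | i \in s]) a i <= \sum_(i <- s) a i.
Proof.
move=> a0; elim: s => [|x s IH].
  by rewrite big_nil (_ : [set i | i \in [::]] = set0) ?esum_set0//; apply/seteqP; split.
rewrite big_cons (_ : [set i | i \in _] = [set x] `|` [set i | i \in s]).
  by apply: (le_trans (esum_setU_le _ _ a0)); rewrite esum_set1// leeD.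
apply/seteqP; split=> y /=; first by rewrite inE => /orP[/eqP|]; [left|right].
by rewrite inE => -[->|->]; rewrite ?eqxx ?orbT.
Qed.

(* The terms exceeding 1/(n+1) are finitely many, for each n. *)
Lemma esum_lty_countable (T : choiceType) (S : set T) (a : T -> R) :
  (forall x, S x -> (0 < a x)%R) -> \esum_(i in S) (a i)%:E < +oo -> countable S.
Proof.
move=> a0 Soo.
have Sfin n : finite_set [set x | S x /\ (n.+1%:R^-1 < a x)%R].
  apply: contrapT => inf; pose s := \esum_(i in S) (a i)%:E.
  have sfin : s \is a fin_num.
    by rewrite ge0_fin_numE// esum_ge0// => i /a0/ltW; rewrite lee_fin.
  have [N Ns] : exists N : nat, (fine s * n.+1%:R < N%:R)%R.
    by exists (Num.bound (fine s * n.+1%:R)); rewrite archi_boundP// mulr_ge0//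
      fine_ge0// esum_ge0// => i /a0/ltW; rewrite lee_fin.
  have [B BS Bn] := infinite_set_fset N inf.
  have : (N%:R * n.+1%:R^-1)%:E <= s.
    apply: esum_ge; exists [set` B].
      by split; [exact: finite_fset|move=> x /BS[]].
    rewrite fsbig_finite//= set_fsetK.
    apply: (@le_trans _ _ (\sum_(x <- B) (n.+1%:R^-1)%:E)).
      by rewrite sumEFin lee_fin big_const_seq iter_addr_0 count_predT
        -[leRHS]mulr_natl ler_wpM2r// ler_nat.
    rewrite big_seq [leRHS]big_seq; apply: lee_sum => x xB.
    by rewrite lee_fin ltW//; have [] := BS x xB.
  rewrite -(fineK sfin) lee_fin ler_pdivrMr// => /le_lt_trans/(_ Ns).
  by rewrite ltxx.
have -> : S = \bigcup_n [set x | S x /\ (n.+1%:R^-1 < a x)%R].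
  apply/seteqP; split=> [x Sx|x [n _ []]//].
  have [//|N] := @ltr_add_invr R 0%R (a x) _; first exact: a0.
  by rewrite add0r => Nx; exists N.
by apply: bigcup_countable => // n _; exact: finite_set_countable.
Qed.

Lemma esum_tail (T : choiceType) (S : set T) (a : T -> \bar R) (e : R) :
  (forall x, 0 <= a x) -> \esum_(i in S) a i < +oo -> (0 < e)%R ->
  exists2 F : {fset T}, [set` F] `<=` S &
    \esum_(i in S `\` [set` F]) a i <= e%:E.
Proof.
move=> a0 Soo e0; pose s := \esum_(i in S) a i.
have sfin : s \is a fin_num by rewrite ge0_fin_numE// esum_ge0.
have [_ [X [finX XS] <-] sX] := ub_ereal_sup_adherent e0 sfin.
exists (fset_set X); first by rewrite fset_setK.
rewrite fset_setK//; have {}sX : s - e%:E < \sum_(i \in X) a i := sX.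
have XE : \esum_(i in X) a i = \sum_(i \in X) a i by rewrite esum_fset.
have split_s : s = \sum_(i \in X) a i + \esum_(i in S `\` X) a i.
  rewrite -XE /s (esumID X)//; congr (esum _ _ + _).
  by apply/seteqP; split=> [x []//|x Xx]; split=> //; exact: XS.
have Xfin : \sum_(i \in X) a i \is a fin_num.
  rewrite ge0_fin_numE; last by rewrite -XE esum_ge0.
  by rewrite -XE; apply: le_lt_trans Soo; exact: esum_subset.
have tfin : \esum_(i in S `\` X) a i \is a fin_num.
  by rewrite ge0_fin_numE ?esum_ge0//; apply: le_lt_trans Soo; exact: esum_subset.
move: sX; rewrite split_s -(fineK Xfin) -(fineK tfin) -EFinD lte_fin lee_fin.
by move: (fine _) (fine _) => u v; lra.
Qed.

End ExtendedSums.

(** * Covers by balls and null sets *)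

Section Gauges.
Context (R : realType).
Implicit Types f : R -> R.

(** The form in which dimension functions enter the covering arguments: positive exactly at positive
    radii, and doubling at every scale. Truncation, below, provides it. *)
Definition gauge f :=
  [/\ {homo f : r s / r <= s}, forall r, r <= 0 -> f r = 0,
      forall r, 0 < r -> 0 < f r
    & exists2 D : R, 0 < D & forall r, f (2 * r) <= D * f r].

Lemma gauge_ge0 f : gauge f -> forall r, 0 <= f r.
Proof.
move=> [_ f0 fgt0 _] r; have [/f0->//|/fgt0/ltW//] := leP r 0.
Qed.

Lemma gauge_scale f t : gauge f ->
  exists2 K : R, 0 < K & forall r, 0 < r -> f (t * r) <= K * f r.
Proof.
move=> gf; have [fm f0 fgt0 [D D0 fD]] := gf.
have pow n r : f (2 ^+ n * r) <= D ^+ n * f r.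
  elim: n => [|n IH]; first by rewrite !expr0 !mul1r.
  rewrite !exprS -!mulrA; apply: (le_trans (fD _)).
  by apply: ler_wpM2l => //; exact: ltW.
have [n tn] : exists n : nat, t <= 2 ^+ n.
  exists (Num.bound `|t|); apply: (le_trans (ler_norm t)).
  apply: (le_trans (ltW (archi_boundP (normr_ge0 t)))).
  by rewrite -natrX ler_nat ltnW// ltn_expl.
exists (D ^+ n); first exact: exprn_gt0.
by move=> r r0; apply: le_trans (pow n r); apply: fm; rewrite ler_pM2r.
Qed.

End Gauges.

Section Covers.
Context (R : realType) (X : metricType R).
Implicit Types (f : R -> R) (A O U : set X) (C : set (X * R)).

(** Covers are sets of pairs (centre, radius): a ball as a set does not determine its radius, so it
    could not be dilated. *)
Definition ball_family C := forall p, C p -> 0 < p.2.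

Definition blowup (t : R) C := \bigcup_(p in C) ball p.1 (t * p.2).

Definition cost f C : \bar R := (\esum_(p in C) (f p.2)%:E)%E.

(** Covers of any cardinality are allowed: for a gauge, a finite cost already forces
    countability. *)
Definition content_ge f A (m : R) :=
  forall C, ball_family C -> A `<=` blowup 1 C -> (m%:E <= cost f C)%E.

Definition content_null f A :=
  forall e : R, 0 < e -> exists C,
    [/\ ball_family C, A `<=` blowup 1 C & (cost f C <= e%:E)%E].

Lemma cost_ge0 f C : gauge f -> (0 <= cost f C)%E.
Proof. by move=> gf; apply: esum_ge0 => p _; rewrite lee_fin gauge_ge0. Qed.

Lemma mball_open (x : X) r : open (ball x r).
Proof.
rewrite openE => y; rewrite ballEmdist /= => xy.
apply/nbhs_ballP; exists (r - mdist x y) => /=; first by rewrite subr_gt0.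
move=> z; rewrite !ballEmdist /= => yz.
by rewrite (le_lt_trans (metric_triangle x y z))// -ltrBrDl.
Qed.

Lemma open_blowup t C : open (blowup t C).
Proof. by apply: bigcup_open => p _; exact: mball_open. Qed.

Lemma blowup_subset s t C : ball_family C -> s <= t -> blowup s C `<=` blowup t C.
Proof.
move=> C0 st x [p Cp px]; exists p => //; apply: le_ball px.
by rewrite ler_pM2r// C0.
Qed.

Lemma content_ge_subset f A B m : A `<=` B -> content_ge f A m -> content_ge f B m.
Proof. by move=> AB mA C C0 BC; apply: mA => // x /AB/BC. Qed.

Lemma content_null_subset f A B : A `<=` B -> content_null f B -> content_null f A.
Proof.
by move=> AB nB e /nB[C [C0 BC Ce]]; exists C; split=> // x /AB/BC.
Qed.

Lemma content_null0 f : content_null f set0.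
Proof.
move=> e e0; exists set0; split=> //; rewrite /cost esum_set0 lee_fin.
exact: ltW.
Qed.

Lemma content_null_bigcup f (A : nat -> set X) : gauge f ->
  (forall n, content_null f (A n)) -> content_null f (\bigcup_n A n).
Proof.
move=> gf nA e e0.
have e2 n : 0 < e / (2 ^ n.+1)%:R by rewrite divr_gt0// ltr0n expn_gt0.
have /choice[C CP] := fun n => nA n _ (e2 n).
exists (\bigcup_n C n); split.
- by move=> p [n _ Cp]; have [/(_ _ Cp)] := CP n.
- move=> x [n _ An]; have [_ /(_ _ An)[p Cp px] _] := CP n.
  by exists p => //; exists n.
- apply: le_trans (esum_bigcup_le _ _) _.
    by move=> p; rewrite lee_fin gauge_ge0.
  apply: (@le_trans _ _ (\sum_(k <oo) (0 + (e / (2 ^ k.+1)%:R)%:E))%E).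
    apply: lee_nneseries => [k _ _|k _].
      by apply: esum_ge0 => p _; rewrite lee_fin gauge_ge0.
    by rewrite add0e; have [] := CP k.
  apply: le_trans (epsilon_trick _ _ _) _ => //; first exact: ltW.
  by rewrite eseries0 ?add0e.
Qed.

Lemma content_null_countable_union f (B : set (set X)) : gauge f -> countable B ->
  (forall b, B b -> content_null f b) -> content_null f (\bigcup_(b in B) b).
Proof.
move=> gf /countable_injP[h hinj] nB.
apply: (content_null_subset (B := \bigcup_n \bigcup_(b in B `&` [set b | h b = n]) b)).
  by move=> x [b Bb bx]; exists (h b) => //; exists b.
apply: content_null_bigcup => // n.
have [[b [Bb bn]]|no] := pselect (exists b, B b /\ h b = n).
  apply: content_null_subset (nB b Bb) => x [b' [Bb' /= b'n] b'x].
  by have <- : b' = b by apply: hinj; [exact: mem_set|exact: mem_set|rewrite bn].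
apply: content_null_subset (content_null0 f) => x [b [Bb bn] _].
by apply: no; exists b.
Qed.

Definition scale (t : R) C : set (X * R) := [set (p.1, t * p.2) | p in C].

Lemma scale_family t C : 0 < t -> ball_family C -> ball_family (scale t C).
Proof. by move=> t0 C0 _ [p Cp <-]; rewrite mulr_gt0// C0. Qed.

Lemma blowup_scale s t C : blowup s (scale t C) = blowup (s * t) C.
Proof.
apply/seteqP; split=> x.
  by move=> [_ [p Cp <-]] /=; rewrite mulrA; exists p.
move=> [p Cp px]; exists (p.1, t * p.2); first by exists p.
by rewrite /= mulrA.
Qed.

Lemma cost_scale f t K C : gauge f -> ball_family C -> 0 < K ->
  (forall r, 0 < r -> f (t * r) <= K * f r) ->
  (cost f (scale t C) <= K%:E * cost f C)%E.
Proof.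
move=> gf C0 K0 fK; apply: (le_trans (esum_image_le _ _ _)) => /=.
apply: ge_ereal_sup => _ [F [finF FC] <-]; rewrite /cost.
apply: (@le_trans _ _ (K%:E * \sum_(p \in F) (f p.2)%:E)%E).
  rewrite ge0_mule_fsumr; last by move=> p; rewrite lee_fin gauge_ge0.
  by apply: lee_fsum => // p /FC Cp; rewrite -EFinM lee_fin fK// C0.
apply: lee_wpmul2l; first by rewrite lee_fin ltW.
by apply: esum_ge; exists F.
Qed.

Lemma blowupU t C C' : blowup t (C `|` C') = blowup t C `|` blowup t C'.
Proof. exact: bigcup_setU. Qed.

Lemma costU_le f C C' : gauge f -> (cost f (C `|` C') <= cost f C + cost f C')%E.
Proof. by move=> gf; apply: esum_setU_le => p; rewrite lee_fin gauge_ge0. Qed.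

(* A point of O outside the blown up balls only meets, within distance d, balls
   of C of radius less than d / (s - 1).  Those are enough to cover U near the
   point, hence cost at least c (f d); as their total cost tends to 0 with d, a
   maximal separated set of such points has few elements. *)
Lemma null_outside_blowup f U O C c s : gauge f -> 0 < c -> 1 < s ->
  (forall x r, 0 < r -> content_ge f (U `&` ball x r) (c * f r)) ->
  open O -> ball_family C -> U `&` O `<=` blowup 1 C -> (cost f C < +oo)%E ->
  content_null f (O `\` blowup s C).
Proof.
move=> gf c0 s1 Uc Oo C0 UOC Coo.
(* A uniform distance to the complement of [O], so that one scale [d] serves all points of [A n]. *)
pose A n := [set x | ball x n.+1%:R^-1 `<=` O] `\` blowup s C.
apply: (content_null_subset (B := \bigcup_n A n)).
  move=> x [Ox xW]; move: Oo; rewrite openE => /(_ _ Ox) /nbhs_ballP[r /= r0 rO].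
  have [//|n] := @ltr_add_invr R 0%R r _; rewrite add0r => nr.
  by exists n => //; split=> // y xy; apply: rO; exact: le_ball (ltW nr) _ xy.
apply: content_null_bigcup => // n e e0.
pose eta : R := n.+1%:R^-1; have eta0 : 0 < eta by rewrite invr_gt0.
have s10 : 0 < s - 1 by rewrite subr_gt0.
(* A ball of radius below [d / (s - 1)] that meets [ball x d] has its centre within
   [d + d / (s - 1) = k * d] of [x]. Points at distance at least [2 * k * d] thus have disjoint
   families of near balls. *)
pose k := 1 + (s - 1)^-1; have k0 : 0 < k by rewrite addr_gt0 ?invr_gt0.
have [K K0 fK] := gauge_scale (2 * k) gf.
have fge0 (p : X * R) : (0 <= (f p.2)%:E)%E by rewrite lee_fin gauge_ge0.
have [F FC Fe] := esum_tail fge0 Coo (divr_gt0 (mulr_gt0 e0 c0) K0).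
(* The finitely many balls of [F] are too large to be near a point of [A n] at this scale, so only
   the cheap tail of [C] pays for separated points. *)
have [d [d0 deta dF]] : exists d : R, [/\ 0 < d, d <= eta &
    forall p, p \in F -> d / (s - 1) <= p.2].
  exists (\big[Num.min/eta]_(p <- F) (p.2 * (s - 1))); split.
  - rewrite big_seq; apply: (big_ind (fun t => 0 < t)) => //.
      by move=> a b a0 b0; rewrite lt_min a0.
    by move=> p /FC/C0 p0; rewrite mulr_gt0.
  - exact: bigmin_le_id.
  - by move=> p pF; rewrite ler_pdivrMr//; exact: (@bigmin_inf_seq _ _ _ _ _ p).
pose near_balls x := [set p | C p /\ ball p.1 p.2 `&` ball x d !=set0].
have small x p : A n x -> near_balls x p -> p.2 < d / (s - 1) /\ mdist x p.1 < k * d.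
  move=> [_ xW] [Cp [z []]]; rewrite !ballEmdist /= => pz xz.
  have px : s * p.2 <= mdist p.1 x.
    by rewrite leNgt; apply/negP => px; apply: xW; exists p => //; rewrite ballEmdist.
  have pzx : mdist p.1 x < p.2 + d.
    by rewrite (le_lt_trans (metric_triangle _ z _))// ltrD// metric_sym.
  have pd : p.2 < d / (s - 1) by rewrite ltr_pdivlMr//; lra.
  split=> //; rewrite metric_sym (lt_trans pzx)// /k mulrDl mul1r.
  by rewrite [_^-1 * d]mulrC; lra.
have cost_near x : A n x -> ((c * f d)%:E <= cost f (near_balls x))%E.
  move=> [xO _]; apply: (Uc x d d0) => [p [/C0]//|y [Uy xy]].
  have [|p Cp py] := UOC y.
    by split=> //; apply: xO; exact: le_ball deta _ xy.
  by exists p => //; split=> //; exists y; split=> //; rewrite -[p.2]mul1r.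
pose separated (t : seq X) := (forall x, x \in t -> A n x) /\
  pairwise (fun x y => 2 * k * d <= mdist x y) t.
have sep_cost t : separated t ->
    (\sum_(x <- t) (c * f d)%:E <= cost f (C `\` [set` F]))%E.
  move=> [tA tsep].
  apply: (@le_trans _ _ (\sum_(x <- t) cost f (near_balls x))%E).
    rewrite big_seq [leRHS]big_seq; apply: lee_sum => x /tA; exact: cost_near.
  apply: esum_pairwise_disjoint => //.
    move=> x /tA Ax p xp; split; first by case: xp.
    by move=> /= /dF; have [pd _] := small _ _ Ax xp; rewrite leNgt pd.
  apply: (sub_in_pairwise (P := [in t])) tsep; last exact/allP.
  move=> x y xt yt xy; apply/asboolP/seteqP; split=> // p [xp yp].
  have [_ xpk] := small _ _ (tA _ xt) xp; have [_ ypk] := small _ _ (tA _ yt) yp.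
  have := metric_triangle x p.1 y; rewrite (metric_sym p.1 y) leNgt => /negP; apply.
  by apply: lt_le_trans xy; rewrite -mulrA mulr_natl mulr2n ltrD.
have fd0 : 0 < f d by have [_ _ -> //] := gf.
have sep_size t : separated t -> (size t)%:R * f d <= e / K.
  move=> /sep_cost /le_trans/(_ Fe); rewrite sumEFin lee_fin big_const_seq.
  rewrite count_predT iter_addr_0 -[leLHS]mulr_natl => te.
  have -> : e / K = e * c / K / c by rewrite [e * c / K]mulrAC mulfK// gt_eqF.
  by rewrite ler_pdivlMr// -[leLHS]mulrA [f d * c]mulrC.
(* [sep_size] bounds the length of separated lists. For a longest one the balls of radius
   [2 * k * d] about its points cover [A n], and [sep_size] also bounds their cost by [e]. *)
pose P := fun m : nat => `[< exists t, separated t /\ size t = m >].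
have Pub m : P m -> (m <= Num.bound (e / K / f d))%N.
  move=> /asboolP[t [/sep_size + <-]]; rewrite -ler_pdivlMr// => tle.
  have := archi_boundP (le_trans (ler0n _ _) tle).
  by move=> /(le_lt_trans tle); rewrite ltr_nat => /ltnW.
have exP : exists m, P m by exists 0; apply/asboolP; exists [::].
have [m /asboolP[t [tsep tm]] mmax] := ex_maxnP exP Pub.
exists [set (x, 2 * k * d) | x in [set x | x \in t]]; split.
- by move=> _ [x _ <-] /=; rewrite !mulr_gt0.
- move=> y Ay; apply: contrapT => yN.
  have : P (size (y :: t)).
    apply/asboolP; exists (y :: t); split=> //; split=> [x|].
      by rewrite inE => /orP[/eqP->|]//; have [tA _] := tsep; exact: tA.
    rewrite /=; case: tsep => [_ ->]; rewrite andbT; apply/allP => x xt.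
    rewrite leNgt; apply/negP => xy; apply: yN; exists (x, 2 * k * d) => /=.
      by exists x.
    by rewrite ballEmdist /= mul1r metric_sym.
  by move/mmax; rewrite /= tm ltnn.
- apply: le_trans (esum_image_le _ _ _) _; apply: le_trans (esum_seq_le _ _) _.
    by move=> x; rewrite lee_fin gauge_ge0.
  rewrite sumEFin lee_fin /= big_const_seq count_predT iter_addr_0 -[leLHS]mulr_natl.
  apply: (@le_trans _ _ ((size t)%:R * (K * f d))); first by rewrite ler_wpM2l// fK.
  by rewrite mulrCA mulrC -ler_pdivlMr// sep_size.
Qed.

End Covers.

(** * Countable intersections *)

Section Topology.
Context (R : realType).

Lemma notin_countable (S : set R) a b : countable S -> a < b ->
  exists t, [/\ a < t, t < b & ~ S t].
Proof.
move=> cS ab; apply: contrapT => no.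
have : countable `]a, b[%classic.
  apply: sub_countable cS; apply: subset_card_le => t /=.
  rewrite in_itv /= => /andP[at_ tb]; apply: contrapT => nSt.
  by apply: no; exists t.
move/countable_lebesgue_measure0; rewrite lebesgue_measure_itv /= lte_fin ab.
by rewrite -EFinB => -[/eqP]; rewrite subr_eq0 gt_eqF.
Qed.

Lemma compact_countable_base (X : metricType R) : compact [set: X] ->
  exists B : set (set X), [/\ countable B, (forall b, B b -> open b) &
    forall x r, 0 < r -> exists b, [/\ B b, b x & b `<=` ball x r]].
Proof.
have [[x0 _] cX|noX _] := pselect (exists x : X, True); last first.
  by exists set0; split=> // x; exfalso; apply: noX; exists x.
pose Xp : pseudoPMetricType R := HB.pack (X : Type) (isPointed.Build X x0) X.
have [B cB [Bo Bx]] := @compact_second_countable R Xp cX.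
exists B; split=> // x r r0.
by have [b [Bb bx] br] := Bx x _ (nbhsx_ballx x r r0); exists b.
Qed.

Lemma compact_finite_cover (X : metricType R) (K : set X) (I : choiceType)
    (D : set I) (V : I -> set X) :
  compact K -> (forall i, D i -> open (V i)) -> K `<=` \bigcup_(i in D) V i ->
  exists2 F : {fset I}, [set` F] `<=` D & K `<=` \bigcup_(i in [set` F]) V i.
Proof.
move=> cK Vo KV; have [[x0 _]|noX] := pselect (exists x : X, True); last first.
  exists fset0%fset; first by move=> i; rewrite /= inE.
  by move=> x; exfalso; apply: noX; exists x.
pose Xp : ptopologicalType := HB.pack (X : Type) (isPointed.Build X x0) X.
have : @cover_compact Xp K by rewrite -compact_cover.
move=> /(_ I D V Vo KV) [F FD KF]; exists F => // i Fi.
exact: set_mem (FD i Fi).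
Qed.

(* Baire category, in the trace of O on K. *)
Lemma compact_baire (X : metricType R) (K O : set X) (U : nat -> set X) (x0 : X) :
  compact [set: X] -> closed K -> open O -> (forall n, open (U n)) ->
  K x0 -> O x0 ->
  (forall n x r, K x -> 0 < r -> ball x r `<=` O ->
     exists y, [/\ U n y, ball x r y & K y]) ->
  exists y, [/\ K y, O y & forall n, U n y].
Proof.
move=> cX cK oO oU Kx0 Ox0 dense.
pose inv (q : X * R) := [/\ K q.1, 0 < q.2 & ball q.1 q.2 `<=` O].
have inside V (x : X) : open V -> V x -> exists2 r : R, 0 < r & ball x r `<=` V.
  by rewrite openE => Vo /Vo /nbhs_ballP[r r0 rV]; exists r.
have /choice[step stepP] : forall nq : nat * (X * R), exists q', inv nq.2 ->
    inv q' /\ ball q'.1 (2 * q'.2) `<=` ball nq.2.1 nq.2.2 `&` U nq.1.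
  move=> [n q]; have [iq|] := pselect (inv q); last by exists q.
  have [Kq q0 qO] := iq; have [y [Uy qy Ky]] := dense n _ _ Kq q0 qO.
  have [r r0 rV] := inside _ _ (openI (mball_open q.1 q.2) (oU n)) (conj qy Uy).
  (* Halving keeps even the doubled ball inside the previous ball and [U n]. The margin is needed
     because the cluster point of the centres is only known to lie in the doubled balls. *)
  exists (y, r / 2) => _ /=; rewrite mulrCA divff// mulr1; split=> //; split=> //=.
    by rewrite divr_gt0.
  move=> z yz; apply: qO; suff [] : (ball q.1 q.2 `&` U n) z by [].
  by apply: rV; apply: le_ball yz; rewrite ler_pdivrMr// ler_pMr// ler1n.
have [r0 r00 r0O] := inside O x0 oO Ox0.
pose q := fix q n := if n is m.+1 then step (m, q m) else (x0, r0).
have invq n : inv (q n) by elim: n => [//|n IH]; have [] := stepP (n, q n) IH.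
have qstep n : ball (q n.+1).1 (2 * (q n.+1).2) `<=` ball (q n).1 (q n).2 `&` U n.
  by have [] := stepP (n, q n) (invq n).
have qnest n m : (n <= m)%N -> ball (q m).1 (q m).2 `<=` ball (q n).1 (q n).2.
  move=> /subnKC <-; elim: (m - n)%N => [|k IH]; first by rewrite addn0.
  rewrite addnS => z qz; apply: IH; suff [] : (ball (q (n + k)%N).1 (q (n + k)%N).2
    `&` U (n + k)%N) z by [].
  apply: qstep; apply: le_ball qz; have [_ q0 _] := invq (n + k).+1.
  by rewrite ler_pMl// ler1n.
have [p [_ pcl]] := cX ((fun n => (q n).1) @ \oo) _ (@filterT _ _ _).
have pin n : ball (q n.+1).1 (2 * (q n.+1).2) p.
  have [_ q0 _] := invq n.+1.
  have [||_ [[m /= nm <-] pq]] := pcl [set (q m).1 | m in [set m | (n < m)%N]]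
      (ball p (q n.+1).2); last 1 first.
  - rewrite mulr_natl mulr2n; apply: ball_triangle (ball_sym pq).
    by apply: (qnest _ _ nm); apply: ballxx; have [] := invq m.
  - by exists n.+1 => // m /= nm; exists m.
  - exact: nbhsx_ballx.
exists p; split.
- apply: cK => V /pcl pV.
  have [|y [Ky Vy]] := pV K; last by exists y.
  by exists 0%N => // m _ /=; have [] := invq m.
- by apply: r0O; have [] := qstep 0%N _ (pin 0%N).
- by move=> n; have [] := qstep n _ (pin n).
Qed.

End Topology.

Section Intersection.
Context (R : realType) (X : metricType R) (f : R -> R) (C : set (X * R)).
Hypotheses (cX : compact [set: X]) (gf : gauge f) (C0 : ball_family C).

(* For an open b, the set of t for which the t-fold balls cover b up to a null
   set is an up-set.  A dilation factor t which is the infimum of none of these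
   sets, for b in a countable base, is stable: if all larger factors cover b,
   then so does t. *)
Lemma stable_dilation (B : set (set X)) : countable B ->
  exists t, [/\ 1 < t, t < 2 & forall b, B b ->
    (forall s, 1 < s -> content_null f (b `\` blowup (s * t) C)) ->
    content_null f (b `\` blowup t C)].
Proof.
move=> cB.
pose S b := [set t | 1 <= t /\ content_null f (b `\` blowup t C)].
have [t [t1 t2 tN]] := @notin_countable R _ 1 2
  (sub_countable (card_image_le (fun b => inf (S b)) B) cB) (ltr1n _ 2).
exists t; split=> // b Bb sb.
have t0 : 0 < t by exact: lt_trans t1.
have lbS : has_lbound (S b) by exists 1 => u [].
have S0 s : 1 < s -> S b (s * t).
  by move=> s1; split; [rewrite mulr_ege1// ltW|exact: sb].
have infle : inf (S b) <= t.
  rewrite leNgt; apply/negP => lt_inf.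
  have q1 : 1 < inf (S b) / t by rewrite ltr_pdivlMr// mul1r.
  have [s [s1 si _]] := notin_countable (@countable0 R) q1.
  have : inf (S b) <= s * t.
    by apply: ge_inf => //; exact: S0.
  by rewrite leNgt -ltr_pdivlMr// si.
(* The infimum differs from [t] by the choice of [t]. Hence some [u < t] already covers [b] up to a
   null set, and so does the larger [t]. *)
have inflt : inf (S b) < t.
  rewrite lt_neqAle infle andbT; apply/eqP => it; apply: tN; by exists b.
have [u [u1 nu] ut] := inf_lt (ex_intro _ _ (S0 2 (ltr1n _ 2))) inflt.
apply: content_null_subset nu => x [bx xt]; split=> // xu; apply: xt.
exact: blowup_subset (ltW ut) _ xu.
Qed.

Lemma cover_intersection (U : nat -> set X) (O : set X) :
  (forall n, open (U n)) ->
  (forall n, exists2 c : R, 0 < c & forall x r, 0 < r ->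
     content_ge f (U n `&` ball x r) (c * f r)) ->
  open O -> \bigcap_n U n `&` O `<=` blowup 1 C -> (cost f C < +oo)%E ->
  content_null f (O `\` blowup 2 C).
Proof.
move=> oU Uc oO UOC Coo.
have [B [cB oB Bbase]] := compact_countable_base cX.
have [t [t1 t2 tstable]] := stable_dilation cB.
have t0 : 0 < t by exact: lt_trans t1.
pose B' := B `&` [set b | content_null f (b `\` blowup t C)].
(* The complement of the set [K] of the overview. As the base is countable, the exceptional null
   sets of its members add up to one for [V]. *)
pose V := \bigcup_(b in B') b.
have nullV : content_null f (V `\` blowup t C).
  apply: (content_null_subset
    (B := \bigcup_(b in (fun b => b `\` blowup t C) @` B') b)).
    by move=> x [[b B'b bx] xC]; exists (b `\` blowup t C) => //; exists b.
  apply: content_null_countable_union => //.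
    apply: sub_countable (card_image_le _ _) _; apply: sub_countable cB.
    by apply: subset_card_le => b [].
  by move=> _ [b [_ nb] <-].
have CV : blowup t C `<=` V.
  move=> x xC; have := open_blowup t C; rewrite openE => /(_ x xC)/nbhs_ballP[r /= r0 rC].
  have [b [Bb bx br]] := Bbase x r r0; exists b => //; split=> //=.
  rewrite (_ : _ `\` _ = set0); first exact: content_null0.
  by apply/seteqP; split=> // y [/br/rC].
have oV : open V by apply: bigcup_open => b [/oB].
suff OV : O `<=` V.
  apply: content_null_subset nullV => x [Ox xC]; split; first exact: OV.
  by move=> xt; apply: xC; exact: blowup_subset (ltW t2) _ xt.
apply: contrapT => nOV.
have [x [Ox nVx]] : exists x, O x /\ ~ V x.
  by apply: contrapT => no; apply: nOV => x Ox; apply: contrapT => nVx;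
    apply: no; exists x.
have [|y [nVy Oy Uy]] := compact_baire cX (open_closedC oV) oO oU nVx Ox; last first.
  apply: nVy; apply: CV; have [|p Cp py] := UOC y; first by split=> // n _; exact: Uy.
  by exists p => //; apply: le_ball py; rewrite ler_pM2r ?C0// ltW.
move=> n {nVx Ox}x r nVx r0 rO; apply: contrapT => noy.
have UV : U n `&` ball x r `<=` V.
  by move=> y [Uy xy]; apply: contrapT => nVy; apply: noy; exists y.
have [b [Bb bx br]] := Bbase x r r0.
apply: nVx; exists b => //; split=> //=; apply: tstable => // s s1.
have [c c0 Unc] := Uc n.
have [K1 K10 fK1] := gauge_scale t gf; have [K2 K20 fK2] := gauge_scale s gf.
move=> e e0.
(* [U n] inside [b] is covered by the [t]-fold balls together with [C1]. The covering consequence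
   dilates [C1] by [s] as well, and [scale s C1] joins the final cover; hence the division by
   [K2]. *)
have [C1 [C10 VC1 C1e]] := nullV _ (divr_gt0 e0 (mulr_gt0 (ltr0n R 2) K20)).
have C2e : (cost f (scale s C1) <= (e / 2)%:E)%E.
  apply: (le_trans (cost_scale gf C10 K20 fK2)).
  apply: (le_trans (lee_wpmul2l _ C1e)); first by rewrite lee_fin ltW.
  by rewrite -EFinM lee_fin invfM mulrCA (mulrC _ K2^-1) mulVKf// gt_eqF.
have fam : ball_family (scale t C `|` C1).
  by move=> p [|/C10//]; exact: scale_family.
have [||] := null_outside_blowup gf c0 s1 Unc (oB _ Bb) fam _ _ (divr_gt0 e0 (ltr0n _ 2)).
- move=> y [Uy by_]; rewrite blowupU blowup_scale mul1r.
  have [yC|yC] := pselect (blowup t C y); [by left|right].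
  by apply: VC1; split=> //; apply: UV; split=> //; exact: br.
- apply: le_lt_trans (costU_le _ _ gf) _; apply: lte_add_pinfty.
    apply: le_lt_trans (cost_scale gf C0 K10 fK1) _.
    by rewrite lte_mul_pinfty// lee_fin ltW.
  by apply: le_lt_trans C1e _; rewrite ltry.
- move=> C3 [C30 bC3 C3e]; exists (C3 `|` scale s C1); split.
  + by move=> p [/C30//|]; apply: scale_family => //; exact: lt_trans s1.
  + move=> y [by_ yC]; rewrite blowupU blowup_scale mul1r.
    have [y1|y1] := pselect (blowup s C1 y); [by right|left].
    by apply: bC3; split=> //; rewrite blowupU blowup_scale => -[].
  + apply: (le_trans (costU_le _ _ gf)).
    by rewrite [e]splitr EFinD leeD.
Qed.

End Intersection.

(** The constants of the [U n] may tend to 0: they only serve to produce null sets. The final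
    constant comes from [c0], the one for full balls, and from the cost [K] of doubling the
    radii. *)
Lemma content_ge_intersection (R : realType) (X : metricType R) (f : R -> R)
    (U : nat -> set X) (c0 : R) :
  compact [set: X] -> gauge f -> 0 < c0 ->
  (forall (x : X) r, 0 < r -> content_ge f (ball x r) (c0 * f r)) ->
  (forall n, open (U n)) ->
  (forall n, exists2 c : R, 0 < c & forall x r, 0 < r ->
     content_ge f (U n `&` ball x r) (c * f r)) ->
  exists2 c : R, 0 < c & forall x r, 0 < r ->
     content_ge f (\bigcap_n U n `&` ball x r) (c * f r).
Proof.
move=> cX gf c00 Xc oU Uc; have [K K0 fK] := gauge_scale 2 gf.
exists (c0 / K) => [|x r r0 C C0 UC]; first exact: divr_gt0.
have [Coo|] := ltP (cost f C) +oo%E; last by rewrite leye_eq => /eqP->; rewrite leey.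
have nul := cover_intersection cX gf C0 oU Uc (mball_open x r) UC Coo.
have Cfin : cost f C \is a fin_num by rewrite ge0_fin_numE ?cost_ge0.
suff : ((c0 * f r)%:E <= K%:E * cost f C)%E.
  rewrite -(fineK Cfin) -EFinM !lee_fin mulrAC => ?.
  by rewrite ler_pdivrMr// [leRHS]mulrC.
apply/lee_addgt0Pr => e e0; have [C' [C'0 xC' C'e]] := nul e e0.
have := Xc x r r0 (scale 2 C `|` C').
move=> /(_ _ _)/le_trans; apply.
- by move=> p [|/C'0//]; apply: scale_family.
- move=> y xy; rewrite blowupU blowup_scale mul1r.
  by have [|yC] := pselect (blowup 2 C y); [left|right; exact: xC'].
- by apply: (le_trans (costU_le _ _ gf)); apply: leeD => //; exact: cost_scale.
Qed.

(** * Weighted content *)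

Lemma count_strict (T : eqType) (P Q : pred T) (s : seq T) t :
  (forall u, u \in s -> P u -> Q u) -> t \in s -> Q t -> ~~ P t ->
  (count P s < count Q s)%N.
Proof.
move=> PQ ts Qt Pt; rewrite -!size_filter.
have -> : [seq u <- s | P u] = [seq u <- [seq u <- s | Q u] | P u].
  rewrite -filter_predI; apply: eq_in_filter => u us /=.
  by case: (boolP (P u)) => // /(PQ _ us)->.
rewrite size_filter -(count_predC P [seq u <- s | Q u]) -addn1 leq_add2l -has_count.
by apply/hasP; exists t => //; rewrite mem_filter Qt.
Qed.

Section WeightedContent.
Context (R : realType) (X : metricType R) (T : choiceType).
Variables (x : T -> X) (r : T -> R).
Implicit Types (s D : seq T) (w : T -> R).

Let inball t y := mdist (x t) y < r t.

Lemma exists_max_radius s : s != [::] ->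
  exists2 t, t \in s & forall u, u \in s -> r u <= r t.
Proof.
elim: s => // t s IH _; have [->|/IH[u us umax]] := eqVneq s [::].
  by exists t => [|u]; rewrite inE// => /eqP->.
have [ru|ru] := leP (r u) (r t).
  exists t; first by rewrite mem_head.
  by move=> v; rewrite inE => /orP[/eqP->//|/umax/le_trans]; apply.
exists u; first by rewrite inE us orbT.
by move=> v; rewrite inE => /orP[/eqP->|/umax//]; exact: ltW.
Qed.

(** Greedy choice: keep a ball of largest radius, discard all balls meeting it, repeat. A discarded
    ball has radius at most that of the kept ball it meets, whence the factor 3. *)
Lemma vitali_metric s : (forall t, t \in s -> 0 < r t) ->
  exists D, [/\ uniq D, {subset D <= s},
    forall t u y, t \in D -> u \in D -> inball t y -> inball u y -> t = u
  & forall t y, t \in s -> inball t y ->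
      exists2 u, u \in D & mdist (x u) y < 3 * r u].
Proof.
move: {2}(size s) (leqnn (size s)) => n; elim: n s => [|n IH] s.
  by rewrite leqn0 size_eq0 => /eqP-> _; exists [::].
move=> sn s0; have [->|sN0] := eqVneq s [::]; first by exists [::].
have [t ts tmax] := exists_max_radius sN0.
pose far u := ~~ `[< exists y, inball t y /\ inball u y >].
have tnear : ~~ far t.
  by rewrite negbK; apply/asboolP; exists (x t); rewrite /inball mdistxx s0.
have s'n : (size (seq.filter far s) <= n)%N.
  rewrite size_filter -ltnS; apply: leq_trans sn; rewrite -(count_predC far s).
  by rewrite -addn1 leq_add2l -has_count; apply/hasP; exists t.
have [|D [uD Ds Ddisj Dcov]] := IH _ s'n.
  by move=> u; rewrite mem_filter => /andP[_ /s0].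
have farD u : u \in D -> far u by move=> /Ds; rewrite mem_filter => /andP[].
exists (t :: D); split.
- by rewrite /= uD andbT; apply/negP => /farD; rewrite (negbTE tnear).
- by move=> u; rewrite inE => /orP[/eqP->//|/Ds]; rewrite mem_filter => /andP[].
- move=> u v y; rewrite !inE => /orP[/eqP->|uD'] /orP[/eqP->|vD'] // yu yv.
  + by have /asboolP[] := farD _ vD'; exists y.
  + by have /asboolP[] := farD _ uD'; exists y.
  + exact: Ddisj vD' yu yv.
- move=> u y us uy; have [fu|] := boolP (far u).
    have [|v vD vy] := Dcov u y _ uy; first by rewrite mem_filter fu.
    by exists v => //; rewrite inE vD orbT.
  rewrite negbK => /asboolP[z [tz uz]]; exists t; first exact: mem_head.
  have := metric_triangle (x t) z y; have := metric_triangle z (x u) y.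
  have := tmax _ us; rewrite (metric_sym z (x u)); move: tz uz uy; rewrite /inball.
  lra.
Qed.

Lemma sum_disjoint_le1 D y : uniq D ->
  (forall t u, t \in D -> u \in D -> inball t y -> inball u y -> t = u) ->
  \sum_(t <- D) (inball t y)%:R <= 1 :> R.
Proof.
move=> uD disj; have [/hasP[t tD ty]|/hasPn no] := boolP (has (inball^~ y) D).
  rewrite (bigD1_seq t)//= ty big1_seq ?addr0// => u /andP[ut uD'].
  by case: (boolP (inball u y)) => // uy; rewrite (disj u t)// eqxx in ut.
by rewrite big1_seq// => t /andP[_ /no/negbTE->].
Qed.

(* Repeatedly subtract the least weight from a disjoint Vitali subfamily of the
   balls of positive weight: its tripled balls cover K, while each point of K
   loses at most what is subtracted. *)
Lemma weighted_content_fin (g : R -> R) (K : set X) (c l : R) s w :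
  gauge g -> uniq s -> (forall t, t \in s -> 0 < r t) ->
  (forall t, t \in s -> 0 <= w t) -> content_ge g K c -> 0 <= l ->
  (forall y, K y -> l <= \sum_(t <- s) w t * (inball t y)%:R) ->
  l * c <= \sum_(t <- s) w t * g (3 * r t).
Proof.
move=> gg us s0 + Kc; pose k := (count (fun t => 0 < w t) s).+1.
have : (count (fun t => (0 < w t)%R) s < k)%N by [].
move: k => n; elim: n l w => [//|n IH] l w wn w0.
rewrite le_eqVlt => /orP[/eqP<- _|l0 cov].
  by rewrite mul0r big_seq sumr_ge0// => t ts; rewrite mulr_ge0 ?w0 ?gauge_ge0.
pose sp := [seq t <- s | 0 < w t].
have [|D [uD Dsp Ddisj Dcov]] := @vitali_metric sp.
  by move=> t; rewrite mem_filter => /andP[_ /s0].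
have Dw t : t \in D -> 0 < w t by move=> /Dsp; rewrite mem_filter => /andP[].
have Ds t : t \in D -> t \in s by move=> /Dsp; rewrite mem_filter => /andP[].
have cD : c <= \sum_(t <- D) g (3 * r t).
  rewrite -lee_fin -sumEFin.
  apply: (le_trans (Kc [set (x t, 3 * r t) | t in [set t | t \in D]] _ _)).
  - by move=> _ [t /Ds ts <-] /=; rewrite mulr_gt0// s0.
  - move=> y Ky; have [t ts ty] : exists2 t, t \in sp & inball t y.
      apply: contrapT => no; have := cov y Ky.
      rewrite big1_seq; first by rewrite leNgt l0.
      move=> t /andP[_ ts]; case: (boolP (inball t y)) => [ty|]; last by rewrite mulr0.
      apply/eqP; rewrite mulr1 eq_le w0// andbT leNgt; apply/negP => wt.
      by apply: no; exists t => //; rewrite mem_filter wt.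
    have [u uD' uy] := Dcov _ _ ts ty.
    by exists (x u, 3 * r u); [exists u|rewrite ballEmdist /= mul1r].
  - apply: le_trans (esum_image_le _ _ _) _ => /=.
    by apply: esum_seq_le => t; rewrite lee_fin gauge_ge0.
(* The cap at [l] keeps the level [l - m] nonnegative. When it is reached, the balls of [D] alone
   already pay for the whole of [l * c]. *)
pose m := \big[Num.min/l]_(t <- D) w t.
have m0 : 0 <= m.
  rewrite /m big_seq; apply: (big_ind (fun t => 0 <= t)); first exact: ltW.
    by move=> a b a0 b0; rewrite le_min a0.
  by move=> t /Dw/ltW.
have ml : m <= l by exact: bigmin_le_id.
have mD t : t \in D -> m <= w t by move=> tD; exact: (@bigmin_inf_seq _ _ _ _ _ t).
pose w' t := w t - m * (t \in D)%:R.
have w'E (h : T -> R) :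
    \sum_(t <- s) w t * h t = \sum_(t <- s) w' t * h t + m * \sum_(t <- D) h t.
  have -> : \sum_(t <- D) h t = \sum_(t <- s) (t \in D)%:R * h t.
    rewrite (perm_big [seq t <- s | t \in D])/=.
      by rewrite big_filter big_mkcond/=; apply: eq_bigr => t _;
        case: (t \in D); rewrite ?mul1r ?mul0r.
    apply: uniq_perm => //; first exact: filter_uniq.
    by move=> t; rewrite mem_filter; have [/Ds->|] := boolP (t \in D).
  rewrite mulr_sumr -big_split /=; apply: eq_bigr => t _.
  by rewrite /w' mulrBl -mulrA subrK.
rewrite w'E -[l](subrK m) mulrDl; apply: lerD; last exact: ler_wpM2l.
have w'0 t : t \in s -> 0 <= w' t.
  move=> ts; rewrite /w'; have [tD|_] := boolP (t \in D); last by rewrite mulr0 subr0 w0.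
  by rewrite mulr1 subr_ge0 mD.
have [ltml|] := ltP m l; last first.
  move=> lm; have -> : m = l by apply/eqP; rewrite eq_le ml.
  rewrite subrr mul0r big_seq sumr_ge0// => t ts.
  by apply: mulr_ge0; [exact: w'0|exact: gauge_ge0].
suff cnt : (count (fun t => (0 < w' t)%R) s < n)%N.
  apply: (IH _ _ cnt w'0); rewrite ?subr_ge0//.
  move=> y Ky; rewrite lerBlDr; apply: (le_trans (cov y Ky)).
  rewrite w'E lerD2l; apply: ler_piMr => //.
  by apply: sum_disjoint_le1 => // t u; exact: Ddisj.
(* As [m < l], the minimum is a weight of some [t] in [D]. This weight drops to 0, so the number of
   positive weights decreases. *)
have [t tD wt] : exists2 t, t \in D & w t = m.
  apply: contrapT => no; have : m < m; last by rewrite ltxx.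
  rewrite {2}/m big_seq; apply: (big_ind (fun t => m < t)) => //.
    by move=> a b am bm; rewrite lt_min am.
  by move=> t tD; rewrite lt_neqAle mD// andbT; apply/eqP => mt; apply: no; exists t.
rewrite -ltnS; apply: leq_trans wn; rewrite ltnS.
have subw u : u \in s -> 0 < w' u -> 0 < w u.
  move=> us'; rewrite /w' subr_gt0; apply: le_lt_trans.
  by rewrite mulr_ge0.
have ts := Ds _ tD.
apply: (count_strict subw ts); first exact: Dw.
by rewrite /w' tD mulr1 wt subrr ltxx.
Qed.

Lemma open_all_balls s : open [set y | all (inball^~ y) s].
Proof.
elim: s => [|t s IH] /=.
  by rewrite (_ : [set _ | _] = setT); [exact: openT|exact/seteqP].
rewrite (_ : [set _ | _] = ball (x t) (r t) `&` [set y | all (inball^~ y) s]).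
  by apply: openI => //; exact: mball_open.
by apply/seteqP; split=> y /=; rewrite ballEmdist /= => /andP.
Qed.

(** Compactness reduces to finitely many balls: near each point a finite partial sum already exceeds
    [l - e'], and it does so on an open set because the balls are open. *)
Lemma weighted_content (g : R -> R) (K : set X) (c l : R) (S : set T) w :
  gauge g -> compact K -> (forall t, S t -> 0 < r t) -> (forall t, 0 <= w t) ->
  content_ge g K c -> 0 <= c -> 0 <= l ->
  (forall y, K y -> (l%:E <= \esum_(t in S) (w t * (inball t y)%:R)%:E)%E) ->
  ((l * c)%:E <= \esum_(t in S) (w t * g (3 * r t))%:E)%E.
Proof.
move=> gg cK S0 w0 Kc c0 l0 cov; apply/lee_addgt0Pr => e e0.
pose e' := e / (c + 1); have c1 : 0 < c + 1 by rewrite ltr_wpDl.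
have e'0 : 0 < e' by rewrite divr_gt0.
have e'c : e' * c <= e by rewrite /e' mulrAC ler_pdivrMr// ler_pM2l// lerDl.
have [le'|le'] := ltP l e'.
  apply: (@le_trans _ _ e%:E); last first.
    by rewrite leeDr// esum_ge0// => t _; rewrite lee_fin mulr_ge0 ?gauge_ge0.
  by rewrite lee_fin; apply: le_trans e'c; rewrite ler_wpM2r// ltW.
(* The open cover is indexed by finite sets [F] of total weight above [l - e']; its members are the
   intersections of the balls of [F]. The case [l < e'] was treated apart because the level [l - e']
   must be nonnegative. *)
pose I := [set F : {fset T} | [set` F] `<=` S /\ l - e' < \sum_(t <- F) w t].
have [||Fs FsI KFs] := @compact_finite_cover R X K _ I
    (fun F => [set y | all (inball^~ y) F]) cK.
- by move=> F _; exact: open_all_balls.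
- move=> y Ky; have : ((l - e')%:E < \esum_(t in S) (w t * (inball t y)%:R)%:E)%E.
    by apply: lt_le_trans (cov y Ky); rewrite lte_fin ltrBlDr ltrDl.
  move=> /ereal_sup_gt[_ [A [finA AS] <-]].
  rewrite fsbig_finite// sumEFin lte_fin => lA.
  exists [fset t in fset_set A | inball t y]%fset; last first.
    by apply/allP => t; rewrite !inE => /andP[].
  split=> [t|]; first by rewrite /= !inE => /andP[]; rewrite in_fset_set// => /set_mem/AS.
  rewrite big_fset /=; apply: (lt_le_trans lA); rewrite [leRHS]big_mkcond /=.
  by apply: ler_sum => t _; case: ifP => _; rewrite ?mulr1 ?mulr0.
pose G := (\bigcup_(F <- Fs) F)%fset; pose s := enum_fset G.
have sP t : t \in s -> exists2 F, F \in Fs & t \in F.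
  by move=> /bigfcupP[F /andP[FF _] tF]; exists F.
have sS t : t \in s -> S t.
  by move=> /sP[F FF tF]; have [FS _] := FsI F FF; exact: FS.
have main : (l - e') * c <= \sum_(t <- s) w t * g (3 * r t).
  apply: (@weighted_content_fin _ K) => //.
  - exact: fset_uniq.
  - by move=> t /sS/S0.
  - by rewrite subr_ge0.
  - move=> y Ky; have [F FF /= /allP Fy] := KFs y Ky.
    have [_ /ltW/le_trans] := FsI F FF; apply.
    have Fs' : {subset enum_fset F <= s}.
      by move=> t tF; apply/bigfcupP; exists F; rewrite ?FF.
    have -> : \sum_(t <- F) w t = \sum_(t <- s | t \in F) w t.
      rewrite -[RHS]big_filter; apply: perm_big; apply: uniq_perm => //.
        by rewrite filter_uniq// fset_uniq.
      by move=> t; rewrite mem_filter; case: (boolP (t \in F)) => [/Fs'->|].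
    rewrite big_mkcond /= big_seq [leRHS]big_seq; apply: ler_sum => t ts.
    case: (boolP (t \in F)) => [/Fy->|_]; first by rewrite mulr1.
    by rewrite mulr_ge0.
have : ((\sum_(t <- s) w t * g (3 * r t))%:E <=
    \esum_(t in S) (w t * g (3 * r t))%:E)%E.
  apply: esum_ge; exists [set t | t \in s].
    by split=> [|t /= /sS//]; exact: finite_seq.
  rewrite -sumEFin fsbig_finite/=; last exact: finite_seq.
  rewrite (perm_big (enum_fset (fset_set [set t | t \in s])))//.
  apply: uniq_perm => //; first exact: fset_uniq.
  move=> t; rewrite in_fset_set; last exact: finite_seq.
  by apply/idP/idP => [ts|]; [exact: mem_set|move/set_mem].
move=> h; apply: (@le_trans _ _ (((l - e') * c)%:E + e%:E)%E).
  by rewrite -EFinD lee_fin; lra.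
by apply: leeD => //; apply: le_trans h; rewrite lee_fin.
Qed.

End WeightedContent.

(** * Products *)

Section MaxProductFacts.
Context (R : realType) (d : nat) (Y : 'I_d -> metricType R).
Local Notation Z := (max_product Y).

Lemma mdist_proj (x y : Z) j : mdist (x j) (y j) <= mdist x y.
Proof. exact: (le_bigmax _ (fun i => mdist (x i) (y i))). Qed.

Lemma mdist_max_lt (x y : Z) r : 0 < r ->
  (forall j, mdist (x j) (y j) < r) -> mdist x y < r.
Proof. by move=> r0 xy; apply/bigmax_ltP; split. Qed.

Lemma open_proj_preimage i (V : set (Y i)) : open V -> open [set z : Z | V (z i)].
Proof.
rewrite !openE => Vo z /= /Vo /nbhs_ballP[r /= r0 rV].
apply/nbhs_ballP; exists r => // y; rewrite ballEmdist /= => zy.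
by apply: rV; rewrite ballEmdist /=; apply: le_lt_trans zy; exact: mdist_proj.
Qed.

Lemma compact_max_product : (forall i, compact [set: Y i]) -> compact [set: Z].
Proof.
move=> cY; pose P := prod_topology Y.
have cP : compact [set: P].
  by have := tychonoff cY; congr (compact _); exact/seteqP.
(* With finitely many coordinates the identity is continuous from the product topology to the max
   metric, so Tychonoff compactness passes over. *)
pose h : P -> Z := fun y => y.
have hc : continuous h.
  move=> y A /nbhs_ballP[r /= r0 rA].
  have : \forall y' \near y, forall i : 'I_d, ball (y i) r (y' i).
    apply: (@filter_forall P _ (fun i (y' : P) => ball (y i) r (y' i)) (nbhs y)
      (nbhs_filter y)) => i.
    exact: (@proj_continuous _ _ i y _ (nbhsx_ballx (y i) r r0)).
  apply: (@filterS P (nbhs y) (nbhs_filter y)) => y' yy'; apply: rA; rewrite ballEmdist /=.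
  by apply: mdist_max_lt => // j; have := yy' j; rewrite ballEmdist.
have := continuous_compact (continuous_subspaceT hc) cP.
by congr (compact _); apply/seteqP; split=> // y _; exists y.
Qed.

End MaxProductFacts.

Section ProductContent.
Context (R : realType) (d : nat) (Y : 'I_d -> metricType R).
Local Notation Z := (max_product Y).
Variables (i : 'I_d) (F : R -> R) (G : 'I_d -> R -> R).
Variables (A : set (Y i)) (K : forall j, set (Y j)) (m0 : R) (m : 'I_d -> R).
Hypotheses (gF : gauge F) (gG : forall j, gauge (G j)).
Hypotheses (cK : forall j, compact (@K j)) (m00 : 0 <= m0) (mge0 : forall j, 0 <= m j).
Hypotheses (AF : content_ge F A m0) (KG : forall j, content_ge (G j) (@K j) (m j)).

Section Sections.
Variable C : set (Z * R).
Hypothesis C0 : ball_family C.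
Hypothesis covC : [set y : Z | A (y i) /\ forall j, j != i -> K (y j)] `<=` blowup 1 C.

Let hit (s : seq 'I_d) (y : Z) (p : Z * R) :=
  [forall j, (j != i) ==> (j \notin s) ==> (mdist (p.1 j) (y j) < p.2)].

(* Partial integration of the covering inequality: the coordinate i has been
   replaced by F, each coordinate j of s by G j, and the other ones are frozen
   at y. *)
Lemma section_content (s : seq 'I_d) (y : Z) : uniq s -> i \notin s ->
  (forall j, j != i -> j \notin s -> K (y j)) ->
  ((m0 * \prod_(j <- s) m j)%:E <=
   \esum_(p in C) (F p.2 * \prod_(j <- s) G j (3 * p.2) * (hit s y p)%:R)%:E)%E.
Proof.
have Fge0 := gauge_ge0 gF; have Gge0 j := gauge_ge0 (gG j).
elim: s y => [|k s IH] y /=.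
  move=> _ _ Ky; rewrite big_nil mulr1.
  (* The balls met by the slice through [y] parallel to [Y i]; their projections to [Y i] cover
     [A]. *)
  pose C' := C `&` [set p | hit [::] y p].
  have -> : (\esum_(p in C) (F p.2 * \prod_(j <- [::]) G j (3 * p.2) * (hit [::] y p)%:R)%:E =
      \esum_(p in C') (F p.2)%:E)%E.
    rewrite /C' esum_mkcondr; apply: eq_esum => p _; rewrite big_nil mulr1.
    case: (boolP (hit [::] y p)) => hp; first by rewrite mem_set// mulr1.
    by rewrite memNset ?mulr0//; exact/negP.
  apply: le_trans (esum_image_le C' (fun p => (p.1 i, p.2)) (fun q => (F q.2)%:E)).
  apply: AF => [_ [p [/C0 p0 _] <-]//|u Au].
  have [|p Cp] := @covC (dfwith y i u).
    rewrite /= dfwithin; split=> // j ji.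
    by rewrite dfwithout 1?eq_sym//; exact: Ky.
  rewrite ballEmdist /= mul1r => pu.
  have pj j := le_lt_trans (mdist_proj p.1 (dfwith y i u) j) pu.
  exists (p.1 i, p.2); last by rewrite ballEmdist /= mul1r; have := pj i; rewrite dfwithin.
  exists p => //; split=> //=; apply/forallP => j; apply/implyP => ji.
  by apply/implyP => _; have := pj j; rewrite dfwithout 1?eq_sym.
move=> /andP[ks us]; rewrite inE negb_or => /andP[ik is_] Ky.
rewrite big_cons [m k * _]mulrC mulrA.
(* The projection of [p] to [Y k] receives as weight everything except the condition on coordinate
   [k]. The induction hypothesis at [dfwith y k u] says that these weights reach the required level
   at every [u] of [K k], and [weighted_content] integrates over [u]. *)
pose w (p : Z * R) := F p.2 * \prod_(j <- s) G j (3 * p.2) * (hit (k :: s) y p)%:R.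
have -> : (\esum_(p in C) (F p.2 * \prod_(j <- k :: s) G j (3 * p.2)
      * (hit (k :: s) y p)%:R)%:E = \esum_(p in C) (w p * G k (3 * p.2))%:E)%E.
  by apply: eq_esum => p _; rewrite big_cons /w; congr EFin; ring.
apply: (weighted_content (x := fun p : Z * R => p.1 k) (K := @K k)) => //.
- by move=> p; rewrite !mulr_ge0// prodr_ge0.
- by rewrite mulr_ge0// prodr_ge0.
move=> u Ku; have := IH (dfwith y k u) us is_.
have Kyu j : j != i -> j \notin s -> K (dfwith y k u j).
  move=> ji js; have [<-|kj] := eqVneq k j; first by rewrite dfwithin.
  by rewrite dfwithout//; apply: Ky => //; rewrite inE negb_or eq_sym kj.
move=> /(_ Kyu) /le_trans; apply; apply: le_esum => p _; rewrite lee_fin /w -[leRHS]mulrA.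
apply: ler_wpM2l; first by rewrite mulr_ge0// prodr_ge0.
rewrite -natrM mulnb ler_nat; case: (boolP (hit s _ p)) => // /forallP hp.
rewrite lt0b; apply/andP; split; last first.
  have := hp k; rewrite dfwithin ks eq_sym ik.
  by [].
apply/forallP => j; apply/implyP => ji; apply/implyP; rewrite inE negb_or => /andP[jk js].
by have := hp j; rewrite ji js /= dfwithout// eq_sym.
Qed.

End Sections.

Lemma content_ge_product (y : Z) :
  content_ge (fun r => F r * \prod_(j | j != i) G j (3 * r))
    [set y : Z | A (y i) /\ forall j, j != i -> K (y j)] (m0 * \prod_(j | j != i) m j).
Proof.
move=> C C0 covC; pose s := [seq j <- enum 'I_d | j != i].
have sP j : (j \in s) = (j != i) by rewrite mem_filter mem_enum andbT.
have us : uniq s by rewrite filter_uniq// enum_uniq.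
have is_ : i \notin s by rewrite sP eqxx.
have prodE (h : 'I_d -> R) : \prod_(j <- s) h j = \prod_(j | j != i) h j.
  by rewrite big_filter big_enum_cond.
have := @section_content C C0 covC s y us is_; rewrite prodE => /(_ _)/le_trans; apply.
  by move=> j ji; rewrite sP ji.
apply: le_esum => p _; rewrite prodE lee_fin ler_piMr ?lern1 ?leq_b1//.
by rewrite mulr_ge0 ?gauge_ge0// prodr_ge0// => j _; exact: gauge_ge0.
Qed.

End ProductContent.

(** * Truncated dimension functions *)

Section Truncation.
Context (R : realType).
Implicit Types f g h : R -> R.

(** With [M] at least the diameter of the space no diameter is affected, while a doubling bound on
    []0, M]] becomes one at all scales. *)
Definition trunc (M : R) f (r : R) := f (Num.max 0 (Num.min r M)).

Lemma trunc_id M f r : 0 <= r -> r <= M -> trunc M f r = f r.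
Proof. by move=> r0 rM; rewrite /trunc min_l// max_r. Qed.

Lemma trunc_ge M f r : 0 <= M -> M <= r -> trunc M f r = f M.
Proof. by move=> M0 Mr; rewrite /trunc min_r// max_r. Qed.

Lemma gauge_trunc M f D : 0 < M -> dimension_function f ->
  (forall r, 0 < r -> 0 < f r) -> 0 < D ->
  (forall r, 0 < r -> 2 * r <= M -> f (2 * r) <= D * f r) -> gauge (trunc M f).
Proof.
move=> M0 [_ fm fge0 f0] fgt0 D0 fD; have MM0 := ltW M0.
have tm : {homo trunc M f : r s / r <= s}.
  move=> r s rs; apply: fm; first by rewrite le_max lexx.
  rewrite ge_max !le_max lexx /=; apply/orP; right.
  by rewrite le_min !ge_min lexx rs orbT.
split=> // [r r0|r r0|].
- by rewrite /trunc max_l// ge_min r0.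
- by apply: fgt0; rewrite lt_max lt_min r0 M0 orbT.
- exists D => // r; have [r0|r0] := leP r 0.
    by rewrite /trunc !max_l ?f0 ?mulr0// ge_min ?r0// mulr_ge0_le0.
  have [rM|/ltW rM] := leP (2 * r) M.
    by rewrite !trunc_id ?fD ?mulr_ge0 ?(ltW r0)//; lra.
  (* Here [r] is at least [M / 2], so doubling at [M / 2] together with monotonicity suffices. *)
  rewrite trunc_ge//; have M2 : 2 * (M / 2) = M by field.
  have := fD (M / 2); rewrite M2 lexx divr_gt0// => /(_ isT isT)/le_trans; apply.
  apply: ler_wpM2l; first exact: ltW.
  have <- : trunc M f (M / 2) = f (M / 2) by apply: trunc_id; lra.
  by apply: tm; lra.
Qed.

(** What is kept of the continuity at 0; it pays for the balls of diameter 0 in a cover. *)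
Definition vanishing f := forall e : R, 0 < e -> exists2 r, 0 < r & f r <= e.

Lemma trunc_vanishing M f : 0 < M -> dimension_function f -> vanishing (trunc M f).
Proof.
move=> M0 [/continuous_within_itvcyP[_ f00] _ _ f0] e e0.
have fe : \forall r \near 0^'+, f r < e by apply: (cvgr_lt _ f00); rewrite f0.
have : \forall r \near 0^'+, [/\ f r < e, r <= M & 0 < r].
  by near=> r; split; near: r; [exact: fe|exact: nbhs_right_le|exact: nbhs_right_gt].
move=> h; have [r [fr rM r0]] := @filter_ex _ _ (at_right_proper_filter 0) _ h.
by exists r => //; rewrite trunc_id// ltW.
Unshelve. all: by end_near. Qed.

(** Cross-multiplied form of: [h / f] is nonincreasing up to the factor [k]. *)
Definition quasi k h f := forall s r, 0 < s -> s <= r ->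
  k * h r * f s <= h s * f r.

Lemma dim_preceq_limit_le h f (l : \bar R) b r0 : 0 < r0 ->
  (h r / f r)%:E @[r --> 0^'+] --> l ->
  (forall r, 0 < r -> r <= r0 -> h r / f r <= b) -> (l <= b%:E)%E.
Proof.
move=> r00 hl hb; rewrite -(cvg_lim _ hl)//; apply: lime_le; first by apply/cvg_ex; exists l.
near=> r; rewrite lee_fin; apply: hb; near: r.
  exact: nbhs_right_gt.
exact: nbhs_right_le.
Unshelve. all: by end_near. Qed.

(** A zero of [h] at [r] would propagate to all of []0, r]] by monotonicity and make the limit of
    [h / f] at 0 vanish. *)
Lemma dim_preceq_gt0 h f : dimension_function h -> dim_preceq h f ->
  forall r, 0 < r -> 0 < h r.
Proof.
move=> [_ hm hge0 _] [_ [l l0 hl]] r r0; rewrite lt_neqAle hge0 ?(ltW r0)// andbT.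
apply/eqP => hr; have : (l <= 0%:E)%E.
  apply: (dim_preceq_limit_le r0 hl) => s s0 sr.
  suff -> : h s = 0 by rewrite mul0r.
  by apply/eqP; rewrite eq_le hge0 ?(ltW s0)// andbT hr hm// ltW.
by rewrite leNgt l0.
Qed.

(* If h / f is nondecreasing then it is bounded and bounded away from 0 on
   ]0, M], hence also nonincreasing up to a constant. *)
Lemma dim_preceq_quasi h f M : 0 < M -> (forall r, 0 < r -> 0 < h r) ->
  (forall r, 0 < r -> 0 < f r) -> dim_preceq h f ->
  exists2 k, 0 < k & quasi k (trunc M h) (trunc M f).
Proof.
move=> M0 h0 f0 [mono [l l0 hl]].
suff [k k0 kq] : exists2 k, 0 < k & forall s r, 0 < s -> s <= r -> r <= M ->
    k * (h r / f r) <= h s / f s.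
  exists k => // s r s0 sr; have r0 := lt_le_trans s0 sr.
  have minE t : 0 < t -> trunc M h t = h (Num.min t M) /\ trunc M f t = f (Num.min t M).
    by move=> t0; rewrite /trunc max_r// le_min !ltW.
  have [-> ->] := minE s s0; have [-> ->] := minE r r0.
  have s1 : 0 < Num.min s M by rewrite lt_min s0.
  have sr1 : Num.min s M <= Num.min r M.
    by rewrite le_min !ge_min lexx sr orbT.
  have r1 := lt_le_trans s1 sr1.
  have := kq _ _ s1 sr1; rewrite ge_min lexx orbT => /(_ isT).
  rewrite ler_pdivlMr ?f0// => /(ler_wpM2r (ltW (f0 _ r1))).
  by congr (_ <= _); field; rewrite gt_eqF// f0.
case: mono => mono; last first.
  by exists 1 => // s r s0 sr _; rewrite mul1r mono.
have lq s : 0 < s -> (l <= (h s / f s)%:E)%E.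
  by move=> s0; apply: (dim_preceq_limit_le s0 hl) => r r0 rs; exact: mono.
have lfin : l \is a fin_num.
  by rewrite ge0_fin_numE ?(ltW l0)//; apply: le_lt_trans (lq M M0) _; rewrite ltry.
have l'0 : 0 < fine l by rewrite fine_gt0// l0 -ge0_fin_numE// ltW.
have q0 : 0 < h M / f M by rewrite divr_gt0 ?h0 ?f0.
(* On []0, M]] the nondecreasing quotient lies between its limit [l] at 0 and its value at [M]. *)
exists (fine l / (h M / f M)); first exact: divr_gt0.
move=> s r s0 sr rM; apply: (@le_trans _ _ (fine l)); last first.
  by rewrite -lee_fin fineK// lq.
rewrite mulrAC ler_pdivrMr// ler_pM2l//; apply: mono => //.
exact: lt_le_trans sr.
Qed.

Lemma gauge_trunc_doubling M g : 0 < M -> dimension_function g -> doubling g ->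
  (forall r, 0 < r -> 0 < g r) -> gauge (trunc M g).
Proof.
move=> M0 dg [D D1 gD] g0; apply: (gauge_trunc M0 dg g0 (lt_trans ltr01 D1)).
by move=> r r0 _; exact/ltW/gD.
Qed.

(** Positivity comes from the strictness of the doubling inequality. *)
Lemma doubling_gt0 g : dimension_function g -> doubling g ->
  forall r, 0 < r -> 0 < g r.
Proof.
move=> [_ gm gge0 _] [D D1 gD] r r0; have D0 := lt_trans ltr01 D1.
rewrite -(pmulr_rgt0 _ D0); apply: le_lt_trans (gD r r0).
by rewrite gge0// mulr_ge0// ltW.
Qed.

(** Doubling is inherited from [g]: since [f / g] is nonincreasing up to [k], the growth of [f] from
    [r] to [2 * r] is at most that of [g] divided by [k]. *)
Lemma gauge_trunc_preceq M f g : 0 < M -> dimension_function f ->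
  dimension_function g -> doubling g -> dim_preceq f g -> gauge (trunc M f).
Proof.
move=> M0 df dg gD fg; have g0 := doubling_gt0 dg gD; have f0 := dim_preceq_gt0 df fg.
have [k k0 kq] := dim_preceq_quasi M0 f0 g0 fg; have [D D1 gD'] := gD.
apply: (@gauge_trunc M f (D / k)) => //; first by rewrite divr_gt0// (lt_trans ltr01).
move=> r r0 rM; have r2 : r <= 2 * r by lra.
have rM' := le_trans r2 rM; have r20 : 0 < 2 * r by lra.
have := kq r (2 * r) r0 r2.
rewrite !(trunc_id _ (ltW r0) rM') !(trunc_id _ (ltW r20) rM).
have fr := f0 r r0; have := gD' r r0; have gr := g0 r r0.
move=> /ltW/(ler_wpM2l (ltW fr)) g2 kf.
rewrite -(ler_pM2r gr) -(ler_pM2l k0) mulrA (le_trans kf)// (le_trans g2)//.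
by rewrite le_eqVlt; apply/orP; left; apply/eqP; field; rewrite gt_eqF.
Qed.

End Truncation.

(** * Transfer of content bounds from one gauge to another *)

Section Comparison.
Context (R : realType) (X : metricType R).
Implicit Types (f h : R -> R) (A : set X) (C : set (X * R)).

Lemma cost_le_mul f h K C : gauge f -> gauge h -> 0 < K ->
  (forall p, C p -> f p.2 <= K * h p.2) -> (cost f C <= K%:E * cost h C)%E.
Proof.
move=> gf gh K0 fK.
apply: ge_ereal_sup => _ [F [finF FC] <-]; rewrite /cost.
apply: (@le_trans _ _ (K%:E * \sum_(p \in F) (h p.2)%:E)%E).
  rewrite ge0_mule_fsumr; last by move=> p; rewrite lee_fin gauge_ge0.
  by apply: lee_fsum => // p /FC Cp; rewrite -EFinM lee_fin fK.
apply: lee_wpmul2l; first by rewrite lee_fin ltW.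
by apply: esum_ge; exists F.
Qed.

Lemma le_of_cost_le_mul (m K : R) f C : 0 < K -> gauge f ->
  (m%:E <= K%:E * cost f C)%E -> ((m / K)%:E <= cost f C)%E.
Proof.
move=> K0 gf; have [Coo|] := ltP (cost f C) +oo%E; last first.
  by rewrite leye_eq => /eqP->; rewrite leey.
have Cfin : cost f C \is a fin_num by rewrite ge0_fin_numE ?cost_ge0.
by rewrite -(fineK Cfin) -EFinM !lee_fin ler_pdivrMr// [X in _ <= X -> _]mulrC.
Qed.

Lemma content_ge_le f A m m' : m' <= m -> content_ge f A m -> content_ge f A m'.
Proof. by move=> mm mA C C0 /(mA C C0); apply: le_trans; rewrite lee_fin. Qed.

(** Either some ball of radius at least [r] costs [h r] by itself, or all radii are at most [r]; in
    that range [quasi] bounds the [f]-cost by [f r / (k * h r)] times the [h]-cost. The minimum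
    accounts for the two cases. *)
Lemma content_ge_quasi f h k c A r : gauge f -> gauge h -> 0 < k -> 0 < c ->
  quasi k h f -> 0 < r -> content_ge f A (c * f r) ->
  content_ge h A (Num.min 1 (k * c) * h r).
Proof.
move=> gf gh k0 c0 q r0 fA C C0 AC.
have [_ _ fgt0 _] := gf; have [hm _ hgt0 _] := gh; have hr := hgt0 r r0.
have [[p [Cp rp]]|no] := pselect (exists p, C p /\ r <= p.2).
  apply: (@le_trans _ _ (h p.2)%:E).
    rewrite lee_fin (le_trans _ (hm _ _ rp))// ler_piMl ?(ltW hr)//.
    by rewrite ge_min lexx.
  have <- : (\esum_(q in [set p]) (h q.2)%:E)%E = (h p.2)%:E.
    by rewrite esum_set1// lee_fin gauge_ge0.
  by apply: esum_subset => _ ->.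
have small p : C p -> p.2 <= r.
  by move=> Cp; rewrite leNgt; apply/negP => rp; apply: no; exists p; split=> //; exact: ltW.
have kh : 0 < k * h r by rewrite mulr_gt0.
have K0 : 0 < f r / (k * h r) by rewrite divr_gt0// fgt0.
have le_fh : (cost f C <= (f r / (k * h r))%:E * cost h C)%E.
  apply: cost_le_mul => // p Cp; rewrite mulrAC ler_pdivlMr// mulrC [leRHS]mulrC.
  exact: q (C0 _ Cp) (small _ Cp).
have := le_of_cost_le_mul K0 gh (le_trans (fA C C0 AC) le_fh).
apply: le_trans; rewrite lee_fin.
have -> : c * f r / (f r / (k * h r)) = k * c * h r.
  by field; rewrite !gt_eqF// fgt0.
by rewrite ler_pM2r// ge_min lexx orbT.
Qed.

End Comparison.

(** * Hausdorff measure *)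

Section Diameter.
Context (R : realType) (X : metricType R).
Implicit Types A : set X.

Lemma diameter_ge0 A : 0 <= diameter A.
Proof.
rewrite /diameter; set S := [set _ | _].
have [[[t St] ubS]|nS] := pselect (has_sup S); last by rewrite sup_out.
apply: le_trans (ub_le_sup ubS St).
by have [x [y [_ _ ->]]] := St; exact: mdist_ge0.
Qed.

Lemma diameter_le A M : 0 <= M ->
  (forall x y, A x -> A y -> mdist x y <= M) -> diameter A <= M.
Proof.
move=> M0 AM; rewrite /diameter; set S := [set _ | _].
have [->|/set0P S0] := eqVneq S set0; first by rewrite sup0.
by apply: ge_sup => // _ [x [y [Ax Ay ->]]]; exact: AM.
Qed.

Lemma mdist_le_diameter A M x y : (forall x y, A x -> A y -> mdist x y <= M) ->
  A x -> A y -> mdist x y <= diameter A.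
Proof.
move=> AM Ax Ay; apply: ub_le_sup; last by exists x, y.
by exists M => _ [u [v [Au Av ->]]]; exact: AM.
Qed.

Lemma diameter_ball_le (x : X) r : 0 < r -> diameter (ball x r) <= 2 * r.
Proof.
move=> r0; apply: diameter_le; first by rewrite mulr_ge0// ltW.
move=> y z; rewrite !ballEmdist /= => xy xz.
have := metric_triangle y x z; rewrite (metric_sym y x); lra.
Qed.

Lemma compact_bounded_mdist : compact [set: X] ->
  exists2 M : R, 0 < M & forall x y : X, mdist x y <= M.
Proof.
move=> cX; have [[x0 _]|noX] := pselect (exists x : X, True); last first.
  by exists 1 => // x; exfalso; apply: noX; exists x.
have [||F _ XF] := @compact_finite_cover R X [set: X] X setT (ball^~ 1) cX.
- by move=> x _; exact: mball_open.
- by move=> x _; exists x => //; exact: ballxx.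
pose M := \big[Num.max/0]_(y <- F) mdist x0 y.
exists (2 * (M + 1)).
  rewrite mulr_gt0// ltr_wpDl// /M; apply: (big_ind (fun t => 0 <= t)) => //.
    by move=> a b a0 _; rewrite le_max a0.
  by move=> y _; exact: mdist_ge0.
have near0 x : mdist x0 x <= M + 1.
  have [y yF] := XF x I; rewrite ballEmdist /= => yx.
  apply: (le_trans (metric_triangle _ y _)); apply: lerD; last exact: ltW.
  exact: (@le_bigmax_seq _ _ _ _ _ y).
move=> x y; have := metric_triangle x x0 y; rewrite (metric_sym x x0).
by have := near0 x; have := near0 y; lra.
Qed.

End Diameter.

Section HausdorffMeasure.
Context (R : realType) (X : metricType R).
Implicit Types (A : set X) (f : R -> R).
Local Open Scope ereal_scope.

Definition nonneg_gauge f := forall r : R, (0 <= r)%R -> (0 <= f r)%R.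

(** Frees the covers from being indexed by natural numbers: [J] is transported along an injection
    into [nat]. *)
Lemma hausdorff_eta_le f (eta : \bar R) A (T : choiceType) (J : set T) (B : T -> set X) :
  countable J ->
  (forall j, J j -> Defs.is_ball (B j) /\ (diameter (B j))%:E <= eta) ->
  A `<=` \bigcup_(j in J) B j ->
  hausdorff_eta f eta A <= \esum_(j in J) (f (diameter (B j)))%:E.
Proof.
move=> /countable_injP[h hinj] JB AB.
have [J0|/set0P[j0 Jj0]] := eqVneq J set0.
  rewrite J0 esum_set0; apply: ereal_inf_lbound; exists set0, (fun=> set0).
  by split; [split=> [i//|x /AB]; rewrite J0 bigcup_set0|rewrite esum_set0].
have /choice[k kP] : forall n, exists j, (h @` J) n -> J j /\ h j = n.
  move=> n; have [[j Jj jn]|nj] := pselect ((h @` J) n); first by exists j.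
  by exists j0 => /nj.
have kh j : J j -> k (h j) = j.
  move=> Jj; have [|Jk hk] := kP (h j); first by exists j.
  by apply: hinj => //; exact: mem_set.
have -> : \esum_(j in J) (f (diameter (B j)))%:E =
    \esum_(n in h @` J) (f (diameter (B (k n))))%:E.
  by rewrite [RHS]esum_image//; apply: eq_esum => j Jj; rewrite kh.
apply: ereal_inf_lbound; exists (h @` J), (B \o k); split=> //; split.
  by move=> _ [j Jj <-] /=; rewrite kh//; exact: JB.
by move=> x /AB[j Jj jx]; exists (h j); [exists j|rewrite /= kh].
Qed.

Lemma hausdorff_eta_subset f eta A B : A `<=` B ->
  hausdorff_eta f eta A <= hausdorff_eta f eta B.
Proof.
move=> AB; apply: le_ereal_inf => t [D [C [[DC BC] tE]]].
by exists D, C; split=> //; split=> // x /AB/BC.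
Qed.

Lemma hausdorff_eta_ge0 f eta A : nonneg_gauge f -> 0 <= hausdorff_eta f eta A.
Proof.
move=> f0; apply: le_ereal_inf_tmp => _ [D [C [_ ->]]]; apply: esum_ge0 => i _.
by rewrite lee_fin f0// diameter_ge0.
Qed.

Lemma hausdorff_eta_setU f eta A B : nonneg_gauge f ->
  hausdorff_eta f eta (A `|` B) <= hausdorff_eta f eta A + hausdorff_eta f eta B.
Proof.
move=> f0; have [Aoo|] := ltP (hausdorff_eta f eta A) +oo; last first.
  rewrite leye_eq => /eqP->; rewrite addye ?leey//.
  by apply: contraTneq (hausdorff_eta_ge0 eta B f0) => ->.
have [Boo|] := ltP (hausdorff_eta f eta B) +oo; last first.
  rewrite leye_eq => /eqP->; rewrite addey ?leey//.
  by apply: contraTneq (hausdorff_eta_ge0 eta A f0) => ->.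
have Afin : hausdorff_eta f eta A \is a fin_num.
  by rewrite ge0_fin_numE// hausdorff_eta_ge0.
have Bfin : hausdorff_eta f eta B \is a fin_num.
  by rewrite ge0_fin_numE// hausdorff_eta_ge0.
apply/lee_addgt0Pr => e e0; have e20 : (0 < e / 2)%R by rewrite divr_gt0.
have [_ [D1 [C1 [[D1C AC1] ->]]] A1] := lb_ereal_inf_adherent e20 Afin.
have [_ [D2 [C2 [[D2C BC2] ->]]] B1] := lb_ereal_inf_adherent e20 Bfin.
pose C (bn : bool * nat) := if bn.1 then C1 bn.2 else C2 bn.2.
pose J := (pair true @` D1) `|` (pair false @` D2).
apply: (@le_trans _ _ (\esum_(j in J) (f (diameter (C j)))%:E)).
  apply: hausdorff_eta_le; first exact: countableP.
    by move=> _ [[i D1i <-]|[i D2i <-]]; [exact: D1C|exact: D2C].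
  move=> x [/AC1[i D1i xi]|/BC2[i D2i xi]].
    by exists (true, i) => //; left; exists i.
  by exists (false, i) => //; right; exists i.
apply: le_trans (esum_setU_le _ _ _) _; first by move=> j; rewrite lee_fin f0// diameter_ge0.
rewrite [e]splitr EFinD addeACA; apply: leeD.
  by apply: le_trans (esum_image_le _ _ _) _; exact: ltW A1.
by apply: le_trans (esum_image_le _ _ _) _; exact: ltW B1.
Qed.

Lemma hausdorff_eta_bigcup f eta A (T : eqType) (s : seq T) (V : T -> set X) :
  nonneg_gauge f -> (forall x, A x -> exists2 t, t \in s & V t x) ->
  hausdorff_eta f eta A <= \sum_(t <- s) hausdorff_eta f eta (V t).
Proof.
move=> f0; elim: s A => [|t s IH] A AV.
  rewrite big_nil -(esum_set0 (fun n : nat => (f (diameter (set0 : set X)))%:E)).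
  by apply: (@hausdorff_eta_le f eta A nat set0 (fun=> set0)) => // x /AV[].
rewrite big_cons; apply: (@le_trans _ _ (hausdorff_eta f eta (V t `|` (A `\` V t)))).
  apply: hausdorff_eta_subset => x Ax.
  by have [|] := pselect (V t x); [left|right].
apply: le_trans (hausdorff_eta_setU _ _ _ f0) _; apply: leeD => //.
apply: IH => x [/AV[u + ux] nx]; rewrite inE => /orP[/eqP ut|us].
  by move: nx; rewrite -ut.
by exists u.
Qed.

Lemma hausdorff_measureE f A :
  hausdorff_measure f A = ereal_sup [set hausdorff_eta f eta%:E A | eta in [set eta | (0 < eta)%R]].
Proof.
have mono : forall eta eta' : R, (eta <= eta')%R ->
    hausdorff_eta f eta'%:E A <= hausdorff_eta f eta%:E A.
  move=> eta eta' le_eta; apply: le_ereal_inf => t [D [C [[DC BC] tE]]].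
  exists D, C; split=> //; split=> // i Di; have [bi di] := DC i Di; split=> //.
  by apply: (le_trans di); rewrite lee_fin.
have /cvg_lim := @nonincreasing_at_right_cvge R (fun eta => hausdorff_eta f eta%:E A)
  0%R +oo%O isT (fun x y _ _ xy => mono x y xy).
rewrite /hausdorff_measure => ->//.
congr ereal_sup; apply/seteqP; split=> _ [eta /= h <-]; exists eta => //=.
  by move: h; rewrite in_itv /= andbT.
by rewrite in_itv /= h.
Qed.

Lemma hausdorff_eta_le_measure f eta A : (0 < eta)%R ->
  hausdorff_eta f eta%:E A <= hausdorff_measure f A.
Proof. by move=> eta0; rewrite hausdorff_measureE; apply: ereal_sup_ubound; exists eta. Qed.

Lemma hausdorff_measure_subset f A B : A `<=` B ->
  hausdorff_measure f A <= hausdorff_measure f B.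
Proof.
move=> AB; rewrite [leLHS]hausdorff_measureE; apply: ge_ereal_sup => _ [eta eta0 <-].
by apply: le_trans (hausdorff_eta_subset f _ AB) _; exact: hausdorff_eta_le_measure.
Qed.

Lemma hausdorff_measure_bigcup f A (T : eqType) (s : seq T) (V : T -> set X) :
  nonneg_gauge f -> (forall x, A x -> exists2 t, t \in s & V t x) ->
  hausdorff_measure f A <= \sum_(t <- s) hausdorff_measure f (V t).
Proof.
move=> f0 AV; rewrite hausdorff_measureE; apply: ge_ereal_sup => _ [eta eta0 <-].
apply: le_trans (hausdorff_eta_bigcup _ f0 AV) _.
by apply: lee_sum => t _; exact: hausdorff_eta_le_measure.
Qed.

End HausdorffMeasure.

(** * Hausdorff content and content bounds *)

Section Conversions.
Context (R : realType) (X : metricType R).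
Implicit Types (A : set X) (f F : R -> R).

(** Closed balls are used because the weighted content requires compact sets. *)
Definition cball (x : X) (r : R) := [set y | mdist x y <= r].

Lemma compact_cball x r : compact [set: X] -> compact (cball x r).
Proof.
move=> cX; apply: (@subclosed_compact _ _ [set: X]) => //.
rewrite (_ : cball x r = ~` [set y | r < mdist x y]).
  apply: open_closedC; rewrite openE => y /= ry; apply/nbhs_ballP.
  exists (mdist x y - r) => /=; first by rewrite subr_gt0.
  move=> z; rewrite ballEmdist /= => yz.
  have := metric_triangle x z y; rewrite (metric_sym z y) => ?; lra.
by apply/seteqP; split=> y; rewrite /cball /=; [move=> ?; apply/negP|move/negP];
  rewrite -leNgt.
Qed.

(** Mass distribution principle with the Hausdorff measure as mass: the closed ball has measure at
    least about [g r], each covering ball at most about [g] of its radius. By compactness finite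
    subadditivity is enough. *)
Lemma content_ge_ahlfors g M : compact [set: X] -> dimension_function g ->
  (forall r, 0 < r -> 0 < g r) -> @ahlfors_regular R X g ->
  0 < diameter [set: X] -> diameter [set: X] <= M ->
  exists2 c : R, 0 < c & forall x r, 0 < r ->
    content_ge (trunc M g) (cball x r) (c * trunc M g r).
Proof.
move=> cX [_ gm gge0 g0] gpos [a [b [a0 b0 reg]]]; set Dl := diameter _ => D0 DM.
have M0 := lt_le_trans D0 DM.
have [||N _ XN] := @compact_finite_cover R X [set: X] X setT (ball^~ Dl) cX.
- by move=> x _; exact: mball_open.
- by move=> x _; exists x => //; exact: ballxx.
(* Regularity stops at radius [Dl]; a larger ball is bounded by the whole space, that is, by
   [size N] balls of radius [Dl]. *)
pose b' := b * (1 + (size N)%:R).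
have b'0 : 0 < b' by rewrite mulr_gt0// ltr_pwDl.
(* Compensates for radii above [Dl], where the truncated [g] may grow up to [g M] while the measure
   is only known to reach [a * g Dl]. *)
pose k := g Dl / g M; have k0 : 0 < k by rewrite divr_gt0 ?gpos.
have k1 : k <= 1 by rewrite ler_pdivrMr ?gpos// mul1r gm// ltW.
have ball_up (p : X * R) : 0 < p.2 ->
    (hausdorff_measure g (ball p.1 p.2) <= (b' * trunc M g p.2)%:E)%E.
  move=> p0; have [pD|/ltW Dp] := leP p.2 Dl.
    rewrite trunc_id ?(ltW p0) ?(le_trans pD)//.
    have /andP[_] := reg p.1 p.2 p0 pD; move=> /le_trans; apply.
    by rewrite lee_fin ler_wpM2r ?gge0 ?(ltW p0)// /b' ler_pMr// lerDl.
  apply: (@le_trans _ _ (\sum_(x <- enum_fset N) hausdorff_measure g (ball x Dl))%E).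
    apply: hausdorff_measure_bigcup => // y _.
    by have [x xN xy] := XN y I; exists x.
  apply: (@le_trans _ _ (\sum_(x <- enum_fset N) (b * g Dl)%:E)%E).
    by apply: lee_sum => x _; have /andP[] := reg x Dl D0 (lexx _).
  rewrite sumEFin lee_fin big_const_seq count_predT iter_addr_0 -[leLHS]mulr_natl.
  have gDp : g Dl <= trunc M g p.2.
    rewrite /trunc; apply: gm; first exact: ltW.
    by rewrite le_max le_min Dp DM orbT.
  rewrite /b' mulrCA -mulrA ler_pM2l// ler_pM ?gge0 ?(ltW D0)//.
  by rewrite lerDr.
exists (a * k / b') => [|x r r0 C C0 xC]; first by rewrite divr_gt0// mulr_gt0.
have [|F FC xF] := compact_finite_cover (@compact_cball x r cX) _ xC.
  by move=> p _; exact: mball_open.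
have mD : Num.min r Dl <= Dl by rewrite ge_min lexx orbT.
have m0 : 0 < Num.min r Dl by rewrite lt_min r0.
have lower : ((a * g (Num.min r Dl))%:E <= hausdorff_measure g (cball x r))%E.
  have /andP[+ _] := reg x _ m0 mD; move=> /le_trans; apply.
  apply: hausdorff_measure_subset => y; rewrite ballEmdist /= => xy.
  by apply/ltW/(lt_le_trans xy); rewrite ge_min lexx.
have upper : (hausdorff_measure g (cball x r) <=
    \sum_(p <- enum_fset F) (b' * trunc M g p.2)%:E)%E.
  apply: (le_trans (hausdorff_measure_bigcup (s := enum_fset F)
    (V := fun p => ball p.1 p.2) _ _)) => //.
    by move=> y /xF[p pF]; rewrite mul1r => py; exists p.
  rewrite big_seq [leRHS]big_seq; apply: lee_sum => p pF.
  by apply: ball_up; apply: C0; exact: FC.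
have Fcost : ((\sum_(p <- enum_fset F) trunc M g p.2)%:E <= cost (trunc M g) C)%E.
  apply: esum_ge; exists [set` F]; first by split; [exact: finite_fset|].
  by rewrite -sumEFin fsbig_finite//= set_fsetK.
apply: le_trans Fcost; have := le_trans lower upper.
rewrite sumEFin !lee_fin -mulr_sumr; set S := \sum_(p <- _) _ => aS.
rewrite mulrAC ler_pdivrMr// [leRHS]mulrC; apply: le_trans aS.
rewrite -mulrA ler_pM2l//.
have [rD|/ltW Dr] := leP r Dl.
  rewrite trunc_id ?(ltW r0) ?(le_trans rD)// ler_piMl// gge0//; exact: ltW.
rewrite /k mulrAC ler_pdivrMr ?gpos// ler_pM2l ?gpos//.
rewrite /trunc; apply: gm; first by rewrite le_max lexx.
by rewrite ge_max (ltW M0) ge_min lexx orbT.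
Qed.

(** The cost is computed from radii and the content from diameters; a diameter is at most twice the
    radius, whence the doubling constant [K]. *)
Lemma content_le_cost f M K A C : (forall x y : X, mdist x y <= M) ->
  gauge (trunc M f) -> 0 <= M -> 0 < K ->
  (forall r, 0 < r -> trunc M f (2 * r) <= K * trunc M f r) ->
  ball_family C -> A `<=` blowup 1 C ->
  (hausdorff_content f A <= K%:E * cost (trunc M f) C)%E.
Proof.
move=> XM gF M0 K0 FK C0 AC; have [Fm _ Fgt0 _] := gF.
have [Coo|] := ltP (cost (trunc M f) C) +oo%E; last first.
  by rewrite leye_eq => /eqP->; rewrite gt0_muley ?leey// lte_fin.
have Ccount : countable C.
  by apply: (esum_lty_countable _ Coo) => p /C0; exact: Fgt0.
have diam_le (p : X * R) : C p -> diameter (ball p.1 p.2) <= 2 * p.2.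
  by move=> /C0; exact: diameter_ball_le.
apply: (@le_trans _ _ (\esum_(p in C) (f (diameter (ball p.1 p.2)))%:E)%E).
  apply: hausdorff_eta_le => //.
    by move=> p Cp; split; [exists p.1, p.2 => //; exact: C0|rewrite leey].
  by move=> x /AC[p Cp]; rewrite mul1r; exists p.
apply: (@le_trans _ _ (cost (trunc M f) (scale 2 C))); last exact: cost_scale.
rewrite /cost /scale esum_image /=; last first.
  move=> p q _ _ [p1 p2]; apply: injective_projections => //.
  by apply: (mulfI _ p2); rewrite pnatr_eq0.
apply: le_esum => p Cp; rewrite lee_fin.
rewrite -(trunc_id (M := M) f (diameter_ge0 _)); first exact: Fm (diam_le p Cp).
by apply: diameter_le.
Qed.

(* A ball of diameter dl lies in the ball of radius 2 dl about its centre, or in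
   arbitrarily small ones if dl = 0. *)
Lemma content_ge_hausdorff f M A m : (forall x y : X, mdist x y <= M) ->
  gauge (trunc M f) -> 0 <= M -> vanishing (trunc M f) ->
  forall K, 0 < K -> (forall r, 0 < r -> trunc M f (2 * r) <= K * trunc M f r) ->
  content_ge (trunc M f) A m -> ((m / K)%:E <= hausdorff_content f A)%E.
Proof.
move=> XM gF M0 van K K0 FK cA; have [Fm F0 Fgt0 _] := gF.
apply: le_ereal_inf_tmp => _ [D [B [[DB AB] ->]]].
apply/lee_addgt0Pr => e e0.
have diamE U : f (diameter (U : set X)) = trunc M f (diameter U).
  by rewrite trunc_id ?diameter_ge0//; apply: diameter_le.
have diam0 U : 0 <= f (diameter (U : set X)) by rewrite diamE gauge_ge0.
have [[x0 _]|noX] := pselect (exists x : X, True); last first.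
  have m0 : m <= 0.
    rewrite -lee_fin; have := cA set0; rewrite /cost esum_set0; apply=> //.
    by move=> x; exfalso; apply: noX; exists x.
  apply: (@le_trans _ _ 0%E); first by rewrite lee_fin pmulr_lle0// invr_gt0.
  rewrite adde_ge0 ?lee_fin ?(ltW e0)//; apply: esum_ge0 => n _.
  by rewrite lee_fin.
have e2 n : 0 < e / (2 ^ n.+1)%:R by rewrite divr_gt0// ltr0n expn_gt0.
have /choice[q qP] : forall n, exists q : X * R, D n ->
    [/\ 0 < q.2, B n `<=` ball q.1 q.2 &
      trunc M f q.2 <= K * (f (diameter (B n)) + e / (2 ^ n.+1)%:R)].
  move=> n; have [Dn|nD] := pselect (D n); last by exists (x0, 0).
  have [[x [r r0 Bx]] _] := DB n Dn.
  have Bxx : B n x by rewrite Bx; exact: ballxx.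
  have Bdl y : B n y -> mdist x y <= diameter (B n).
    by move=> By; apply: (@mdist_le_diameter _ _ _ M).
  have := diameter_ge0 (B n); rewrite le_eqVlt => /orP[/eqP dl0|dl0].
    have [t t0 ft] := van _ (mulr_gt0 K0 (e2 n)).
    exists (x, t) => _; split=> //=.
      by move=> y /Bdl; rewrite -dl0 ballEmdist /= => /le_lt_trans; apply.
    by apply: (le_trans ft); rewrite ler_pM2l// lerDr.
  exists (x, 2 * diameter (B n)) => _; split=> /=; first by rewrite mulr_gt0.
    by move=> y /Bdl; rewrite ballEmdist /= => /le_lt_trans; apply; lra.
  apply: (le_trans (FK _ dl0)); rewrite ler_pM2l// -diamE lerDl; exact: ltW.
have cq : (m%:E <= cost (trunc M f) (q @` D))%E.
  apply: cA => [_ [n Dn <-]|x /AB[n Dn nx]]; first by have [] := qP n Dn.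
  exists (q n); first by exists n.
  by rewrite mul1r; have [_ + _] := qP n Dn; apply.
have : (m%:E <= \esum_(n in D) (K * (f (diameter (B n)) + e / (2 ^ n.+1)%:R))%:E)%E.
  apply: (le_trans cq); apply: (le_trans (esum_image_le _ _ _)).
  by apply: le_esum => n Dn; rewrite lee_fin; have [] := qP n Dn.
set S := (\esum_(n in D) (f (diameter (B n)))%:E)%E.
have S0 : (0 <= S)%E by apply: esum_ge0 => n _; rewrite lee_fin.
move=> mS; have [Soo|] := ltP S +oo%E; last first.
  by rewrite leye_eq => /eqP->; rewrite addye// leey.
have Sfin : S \is a fin_num by rewrite ge0_fin_numE.
have : (m%:E <= K%:E * (S + e%:E))%E.
  apply: (le_trans mS); apply: ge_ereal_sup => _ [P [finP PD] <-].
  under eq_fsbigr do rewrite EFinM.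
  rewrite -ge0_mule_fsumr; last by move=> n; rewrite lee_fin addr_ge0// ltW.
  apply: lee_wpmul2l; first by rewrite lee_fin ltW.
  apply: (@le_trans _ _ (\esum_(n in D) ((f (diameter (B n)))%:E + (e / (2 ^ n.+1)%:R)%:E))%E).
    by apply: esum_ge; exists P.
  rewrite esumD => [|n _|n _]; [|by rewrite lee_fin|by rewrite lee_fin ltW].
  apply: leeD => //.
  apply: (@le_trans _ _ (\esum_(n in [set: nat]) (e / (2 ^ n.+1)%:R)%:E)%E).
    exact: esum_subset.
  rewrite -nneseries_esumT; last by move=> n; rewrite lee_fin ltW.
  apply: (@le_trans _ _ (\sum_(n <oo) (0 + (e / (2 ^ n.+1)%:R)%:E))%E).
    by apply: lee_nneseries => [n _ _|n _]; rewrite ?add0e// lee_fin ltW.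
  apply: le_trans (epsilon_trick _ _ _) _ => //; first exact: ltW.
  by rewrite eseries0 ?add0e.
rewrite -(fineK Sfin) -EFinD -EFinM !lee_fin => h.
by rewrite ler_pdivrMr// mulrC.
Qed.

Lemma content_le_gauge f M (x : X) r : (forall x y : X, mdist x y <= M) ->
  gauge (trunc M f) -> 0 <= M -> 0 < r ->
  (hausdorff_content f (ball x r) <= (trunc M f (2 * r))%:E)%E.
Proof.
move=> XM gF M0 r0; have [Fm _ _ _] := gF.
apply: (@le_trans _ _ (\esum_(u in [set tt]) (f (diameter (ball x r)))%:E)%E).
  apply: hausdorff_eta_le => //; last by move=> y xy; exists tt.
  by move=> _ _; split; [exists x, r|rewrite leey].
have E : f (diameter (ball x r)) = trunc M f (diameter (ball x r)).
  by rewrite trunc_id ?diameter_ge0//; apply: diameter_le.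
rewrite esum_set1 E lee_fin ?gauge_ge0//.
exact: Fm (diameter_ball_le x r0).
Qed.

End Conversions.

(** * Large intersection classes *)

Section LargeIntersection.
Context (R : realType) (X : metricType R) (M : R).
Hypotheses (M0 : 0 < M) (XM : forall x y : X, mdist x y <= M).
Implicit Types (A : set X) (f g : R -> R).

(** In a space of diameter 0 every content is at most [f 0 = 0], which the strict inequality in the
    definition of the class excludes. *)
Lemma diameter_gt0 f A (x : X) : dimension_function f ->
  large_intersection_class f A -> 0 < diameter [set: X].
Proof.
move=> [_ fm fge0 f0] [_ [c c0 cA]]; rewrite lt_neqAle diameter_ge0 andbT.
apply/eqP => d0; have iB : Defs.is_ball (ball x 1) by exists x, 1.
have dB : diameter (ball x 1) = 0.
  apply/eqP; rewrite eq_le diameter_ge0 andbT; apply: diameter_le => // y z _ _.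
  by rewrite d0; apply: (@mdist_le_diameter _ _ _ M).
have : (hausdorff_content f (A `&` ball x 1) <= 0)%E.
  apply: (@le_trans _ _ (\esum_(u in [set tt]) (f (diameter (ball x 1)))%:E)%E).
    apply: hausdorff_eta_le => //; last by move=> y [_ xy]; exists tt.
    by move=> _ _; split=> //; rewrite leey.
  by rewrite esum_set1 dB f0.
apply/negP; rewrite -ltNge; apply: le_lt_trans (cA _ iB).
by rewrite mule_ge0 ?lee_fin ?(ltW c0)//; exact: hausdorff_eta_ge0.
Qed.

Lemma content_ge_ball f c : gauge f -> 0 < c ->
  (forall (x : X) r, 0 < r -> content_ge f (cball x r) (c * f r)) ->
  exists2 c', 0 < c' & forall (x : X) r, 0 < r -> content_ge f (ball x r) (c' * f r).
Proof.
move=> gf c0 cf; have [K K0 fK] := gauge_scale 2 gf.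
exists (c / K) => [|x r r0]; first exact: divr_gt0.
have r2 : 0 < r / 2 by rewrite divr_gt0.
apply: (@content_ge_subset _ _ _ (cball x (r / 2))).
  by move=> y; rewrite ballEmdist /cball /= => /le_lt_trans; apply; lra.
apply: content_ge_le (cf x _ r2); rewrite mulrAC ler_pdivrMr// -mulrA ler_pM2l//.
by have := fK _ r2; rewrite [2 * _]mulrC divfK// [K * _]mulrC.
Qed.

(** The class only compares [A] with the content of balls. That this content is of order [f r] comes
    from the regularity for [g], carried over to [f] by [dim_preceq f g]. *)
Lemma content_ge_large f g A : compact [set: X] -> dimension_function f ->
  dimension_function g -> doubling g -> dim_preceq f g -> @ahlfors_regular R X g ->
  0 < diameter [set: X] -> large_intersection_class f A ->
  exists2 c, 0 < c & forall (x : X) r, 0 < r ->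
    content_ge (trunc M f) (A `&` ball x r) (c * trunc M f r).
Proof.
move=> cX df dg gD fg areg D0 [_ [c c0 cA]].
have g0 := doubling_gt0 dg gD; have f0 := dim_preceq_gt0 df fg.
have gF := gauge_trunc_preceq M0 df dg gD fg.
have gG := gauge_trunc_doubling M0 dg gD g0.
have DM : diameter [set: X] <= M by apply: diameter_le => //; exact: ltW.
have [c1 c10 Gc1] := content_ge_ahlfors cX dg g0 areg D0 DM.
have [c2 c20 Gc2] := content_ge_ball gG c10 Gc1.
have [k k0 q] := dim_preceq_quasi M0 f0 g0 fg.
have [K K0 FK] := gauge_scale 2 gF; have M0' := ltW M0.
have c30 : 0 < Num.min 1 (k * c2) by rewrite lt_min ltr01 mulr_gt0.
exists (c * (Num.min 1 (k * c2) / K) / K) => [|x r r0 C C0 AC].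
  by rewrite divr_gt0// mulr_gt0// divr_gt0.
have hB := content_ge_hausdorff XM gF M0' (trunc_vanishing M0 df) K0 FK
  (content_ge_quasi gG gF k0 c20 q r0 (Gc2 x r r0)).
have hA := content_le_cost XM gF M0' K0 FK C0 AC.
rewrite mulrAC; apply: le_of_cost_le_mul => //; apply: le_trans hA.
apply: le_trans (ltW (cA _ (ex_intro _ x (ex_intro2 _ _ r r0 erefl)))).
rewrite -[c * _ * _]mulrA EFinM; apply: lee_wpmul2l; first by rewrite lee_fin ltW.
by rewrite mulrAC.
Qed.

Lemma large_of_content_ge f A c : gauge (trunc M f) -> vanishing (trunc M f) ->
  borel_hierarchy.Gdelta A -> 0 < c ->
  (forall (x : X) r, 0 < r ->
     content_ge (trunc M f) (A `&` ball x r) (c * trunc M f r)) ->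
  large_intersection_class f A.
Proof.
move=> gF van GA c0 cA; split=> //; have [K K0 FK] := gauge_scale 2 gF.
have M0' := ltW M0; have [_ _ Fgt0 _] := gF.
(* One [K] for passing from radii to diameters on each side, and the 2 makes the inequality
   strict. *)
exists (c / (2 * K * K)) => [|_ [x [r r0 ->]]]; first by rewrite divr_gt0// !mulr_gt0.
apply: lt_le_trans (content_ge_hausdorff XM gF M0' van K0 FK (cA x r r0)).
apply: le_lt_trans (lee_wpmul2l _ (content_le_gauge x XM gF M0' r0)) _.
  by rewrite lee_fin ltW// divr_gt0// !mulr_gt0.
rewrite -EFinM lte_fin; apply: (@le_lt_trans _ _ (c / (2 * K * K) * (K * trunc M f r))).
  by rewrite ler_wpM2l ?FK// ltW// divr_gt0// !mulr_gt0.
have Fr := Fgt0 r r0; have -> : c / (2 * K * K) * (K * trunc M f r) = c * trunc M f r / K / 2.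
  by field; rewrite gt_eqF.
by rewrite ltr_pdivrMr// ltr_pMr ?ltr1n// divr_gt0// mulr_gt0.
Qed.

End LargeIntersection.

(** * Product gauges and the content of a single cylinder *)

Section TildeGauge.
Context (R : realType) (d : nat) (i : 'I_d) (G F : 'I_d -> R -> R).
Hypotheses (gG : forall j, gauge (G j)) (gF : gauge (F i)).

Lemma prodG_ge0 r : 0 <= \prod_(j < d | j != i) G j r.
Proof. by rewrite prodr_ge0// => j _; exact: gauge_ge0. Qed.

Lemma dim_tilde_le H K : (forall j, gauge (H j)) -> (forall j, 0 < K j) ->
  (forall j r, 0 < r -> H j r <= K j * G j r) ->
  forall r, 0 < r -> dim_tilde H F i r <= (\prod_(j < d | j != i) K j) * dim_tilde G F i r.
Proof.
move=> gH K0 HG r r0; rewrite /dim_tilde mulrCA ler_wpM2l ?gauge_ge0//.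
rewrite -big_split /=; apply: ler_prod => j _.
by rewrite gauge_ge0//= HG.
Qed.

Lemma gauge_tilde : gauge (dim_tilde G F i).
Proof.
have [Fm F0 Fgt0 [DF DF0 FD]] := gF.
have Gm j : {homo G j : r s / r <= s} by have [] := gG j.
have Ggt0 j r : 0 < r -> 0 < G j r by have [_ _ h _] := gG j; exact: h.
have /choice[D DP] : forall j, exists D, 0 < D /\ forall r, G j (2 * r) <= D * G j r.
  by move=> j; have [_ _ _ [D D0 GD]] := gG j; exists D.
split=> [r s rs|r r0|r r0|].
- apply: ler_pM; rewrite ?gauge_ge0 ?prodG_ge0 ?Fm//.
  by apply: ler_prod => j _; rewrite gauge_ge0//= Gm.
- by rewrite /dim_tilde F0// mul0r.
- by rewrite /dim_tilde mulr_gt0 ?Fgt0// prodr_gt0// => j _; exact: Ggt0.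
- exists (DF * \prod_(j < d | j != i) D j).
    by rewrite mulr_gt0// prodr_gt0// => j _; have [] := DP j.
  move=> r; rewrite /dim_tilde mulrACA -big_split /=.
  apply: ler_pM; rewrite ?gauge_ge0 ?prodG_ge0 ?FD//.
  by apply: ler_prod => j _; rewrite gauge_ge0//=; have [] := DP j.
Qed.

Lemma vanishing_tilde : vanishing (F i) -> vanishing (dim_tilde G F i).
Proof.
move=> van e e0; have [Fm _ _ _] := gF; pose P := \prod_(j < d | j != i) G j 1.
have P0 : 0 < P by rewrite prodr_gt0// => j _; have [_ _ + _] := gG j; apply.
have [r r0 Fr] := van _ (divr_gt0 e0 P0).
exists (Num.min r 1); first by rewrite lt_min r0 ltr01.
rewrite -[leRHS](divfK (lt0r_neq0 P0)) /dim_tilde; apply: ler_pM.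
- exact: gauge_ge0.
- exact: prodG_ge0.
- by apply: le_trans Fr; apply: Fm; rewrite ge_min lexx.
- apply: ler_prod => j _; rewrite gauge_ge0//=; have [Gm _ _ _] := gG j.
  by apply: Gm; rewrite ge_min lexx orbT.
Qed.

End TildeGauge.

Lemma gauge_dilate (R : realType) (f : R -> R) t : 0 < t -> gauge f ->
  gauge (fun r => f (t * r)).
Proof.
move=> t0 [fm f0 fgt0 [D D0 fD]]; split=> [r s rs|r r0|r r0|].
- by apply: fm; rewrite ler_pM2l.
- by apply: f0; rewrite pmulr_rle0.
- by apply: fgt0; exact: mulr_gt0.
- by exists D => // r; rewrite mulrCA.
Qed.

Section Cylinder.
Context (R : realType) (d : nat) (Y : 'I_d -> metricType R).
Local Notation Z := (max_product Y).
Variables (G F : 'I_d -> R -> R) (c : 'I_d -> R).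
Hypotheses (gG : forall j, gauge (G j)) (cY : forall j, compact [set: Y j]).
Hypotheses (c0 : forall j, 0 < c j).
Hypothesis Gc : forall j (x : Y j) r, 0 < r -> content_ge (G j) (cball x r) (c j * G j r).

Lemma content_ge_cylinder i (U : set (Y i)) (c1 : R) : gauge (F i) -> 0 < c1 ->
  (forall x r, 0 < r -> content_ge (F i) (U `&` ball x r) (c1 * F i r)) ->
  exists2 c', 0 < c' & forall (z : Z) r, 0 < r ->
    content_ge (dim_tilde G F i) ([set z : Z | U (z i)] `&` ball z r) (c' * dim_tilde G F i r).
Proof.
move=> gF c10 Uc; have gT := gauge_tilde gG gF.
pose G3 := fun j r => G j (3 * r).
have gG3 j : gauge (G3 j) by exact: gauge_dilate.
have gT3 := gauge_tilde gG3 gF.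
have /choice[K KP] : forall j, exists K, 0 < K /\ forall r, 0 < r -> G3 j r <= K * G j r.
  by move=> j; have [K K0 GK] := gauge_scale 3 (gG j); exists K.
have /choice[K2 K2P] : forall j, exists K, 0 < K /\ forall r, 0 < r -> G j (2 * r) <= K * G j r.
  by move=> j; have [K' K0 GK] := gauge_scale 2 (gG j); exists K'.
pose PK := \prod_(j < d | j != i) K j.
have PK0 : 0 < PK by rewrite prodr_gt0// => j _; have [] := KP j.
(* [PK] absorbs the factor 3 left by the Vitali covers. Each [K2 j] pays for closed balls of radius
   [r / 2], which fit into the open ball of radius [r]. *)
exists (c1 * \prod_(j < d | j != i) (c j / K2 j) / PK) => [|z r r0].
  rewrite divr_gt0// mulr_gt0// prodr_gt0// => j _.
  by rewrite divr_gt0//; have [] := K2P j.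
have r2 : 0 < r / 2 by rewrite divr_gt0.
move=> C C0 UC; rewrite mulrAC; apply: le_of_cost_le_mul => //.
apply: (@le_trans _ _ (cost (dim_tilde G3 F i) C)); last first.
  apply: cost_le_mul => // p /C0 p0; apply: dim_tilde_le => //.
    by move=> j; have [] := KP j.
  by move=> j; have [] := KP j.
have m00 : 0 <= c1 * F i r by apply: mulr_ge0; [exact: ltW|exact: gauge_ge0].
have mge0 j : 0 <= c j * G j (r / 2) by apply: mulr_ge0; [exact: ltW|exact: gauge_ge0].
have cov : [set y : Z | (U `&` ball (z i) r) (y i) /\
    forall j, j != i -> cball (z j) (r / 2) (y j)] `<=` blowup 1 C.
  move=> y [[Uy zy] zyj]; apply: UC; split=> //; rewrite ballEmdist /=.
  apply: mdist_max_lt => // j; have [->|ji] := eqVneq j i.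
    by move: zy; rewrite ballEmdist.
  by apply: le_lt_trans (zyj j ji) _; lra.
have := @content_ge_product R d Y i (F i) G _ _ _ _ gF gG
  (fun j => @compact_cball R (Y j) (z j) (r / 2) (@cY j)) m00 mge0 (@Uc (z i) r r0)
  (fun j => @Gc j (z j) _ r2) z C C0 cov.
apply: le_trans; rewrite lee_fin /dim_tilde mulrACA -mulrA -[leRHS]mulrA.
rewrite ler_pM2l// ler_wpM2l ?gauge_ge0// -big_split /=.
apply: ler_prod => j _; have [K20 GK2] := K2P j.
apply/andP; split.
  by apply: mulr_ge0; [exact/ltW/divr_gt0|exact: gauge_ge0].
rewrite -mulrA ler_pM2l// mulrC ler_pdivrMr// [leRHS]mulrC.
by have := GK2 _ r2; rewrite [2 * _]mulrC divfK.
Qed.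

End Cylinder.

(** Numbers that encode nothing contribute the whole space; an intersection over pairs (coordinate,
    index) thus becomes one over [nat]. *)
Lemma bigcap_unpickle (D : countType) (T : Type) (V : D -> set T) :
  \bigcap_n (if @choice.unpickle D n is Some a then V a else setT) = \bigcap_a V a.
Proof.
apply/seteqP; split=> x Vx.
  by move=> a _; have := Vx (choice.pickle a) I; rewrite choice.pickleK.
by move=> n _; case: (choice.unpickle n) => // a; exact: Vx.
Qed.

(** * Both claims as one intersection of open cylinders *)

Section ProductTheorem.
Context (R : realType) (d : nat) (Y : 'I_d -> metricType R).
Variables (g f : 'I_d -> R -> R) (E : forall i : 'I_d, nat -> set (Y i)).
Local Notation Z := (max_product Y).
Hypotheses (Ycompact : forall i, compact [set: Y i])
  (gdim : forall i, dimension_function (g i))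
  (gdoubling : forall i, doubling (g i))
  (Yregular : forall i, @ahlfors_regular R (Y i) (g i))
  (fdim : forall i, dimension_function (f i))
  (f_preceq_g : forall i, dim_preceq (f i) (g i))
  (Eopen : forall i n, open (@E i n))
  (Elarge : forall i, large_intersection_class (f i) (lim_sup_set (@E i))).

Let tail i n : set Z := [set x | (\bigcup_(m >= n) @E i m) (x i)].

Lemma open_tail i n : open (tail i n).
Proof. by apply: open_proj_preimage; apply: bigcup_open => m _; exact: Eopen. Qed.

(* J is a single coordinate in the first claim, all of them in the second. *)
Lemma large_limsup_product k (J : pred 'I_d) (j0 : 'I_d) : J j0 ->
  (forall i, J i -> i = k \/ dim_preceq (dim_tilde g f k) (dim_tilde g f i)) ->
  large_intersection_class (dim_tilde g f k)
    [set x : Z | forall i, J i -> lim_sup_set (@E i) (x i)].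
Proof.
move=> Jj0 Jk.
pose V (a : 'I_d * nat) := if J a.1 then tail a.1 a.2 else setT.
pose U n := if @choice.unpickle ('I_d * nat)%type n is Some a then V a else setT.
have AE : [set x : Z | forall i, J i -> lim_sup_set (@E i) (x i)] = \bigcap_n U n.
  rewrite bigcap_unpickle; apply/seteqP; split=> x Ax.
    by move=> [i n] _; rewrite /V /=; case: ifP => // /Ax /(_ n I).
  by move=> i Ji n _; have := Ax (i, n) I; rewrite /V /= Ji.
have oU n : open (U n).
  rewrite /U; case: choice.unpickle => [[i m]|]; last exact: openT.
  by rewrite /V /=; case: ifP => _; [exact: open_tail|exact: openT].
have GA : borel_hierarchy.Gdelta [set x : Z | forall i, J i -> lim_sup_set (@E i) (x i)].
  by rewrite AE; exists U.
have [[z0 _]|noZ] := pselect (exists z : Z, True); last first.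
  by split=> //; exists 1 => // B [z _]; exfalso; apply: noZ; exists z.
have /choice[Mi MiP] : forall i, exists M : R, forall x y : Y i, mdist x y <= M.
  by move=> i; have [M _ MP] := compact_bounded_mdist (@Ycompact i); exists M.
(* A common height for all coordinates makes truncation commute with the products [dim_tilde];
   starting the maximum at 1 makes it positive. *)
pose M := \big[Num.max/1]_i Mi i.
have M1 : 1 <= M by exact: bigmax_ge_id.
have M0 : 0 < M by exact: lt_le_trans M1.
have YM i (x y : Y i) : mdist x y <= M.
  by apply: (le_trans (MiP i x y)); exact: (le_bigmax _ Mi).
have ZM (x y : Z) : mdist x y <= M.
  by apply/bigmax_leP; split=> [|i _]; [exact: ltW|exact: YM].
have cZ : compact [set: Z] by exact: compact_max_product.
have gpos i := doubling_gt0 (gdim i) (@gdoubling i).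
have fpos i := dim_preceq_gt0 (fdim i) (@f_preceq_g i).
pose G i := trunc M (g i); pose F i := trunc M (f i).
have gG i : gauge (G i) := gauge_trunc_doubling M0 (gdim i) (@gdoubling i) (gpos i).
have gF i : gauge (F i) := gauge_trunc_preceq M0 (fdim i) (gdim i) (@gdoubling i) (@f_preceq_g i).
have tildeE i : trunc M (dim_tilde g f i) = dim_tilde G F i by [].
have gT i : gauge (dim_tilde G F i) by exact: gauge_tilde.
have diam0 i : 0 < diameter [set: Y i].
  exact: (diameter_gt0 (@YM i) (z0 i) (fdim i) (Elarge i)).
have /choice[c cP] : forall i, exists c, 0 < c /\ forall (x : Y i) r, 0 < r ->
    content_ge (G i) (cball x r) (c * G i r).
  move=> i; have [|c c0 cG] := @content_ge_ahlfors R (Y i) (g i) M (@Ycompact i)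
    (gdim i) (gpos i) (Yregular i) (diam0 i); last by exists c.
  by apply: diameter_le => //; exact: ltW.
have cyl i n : exists2 c', 0 < c' & forall (z : Z) r, 0 < r ->
    content_ge (dim_tilde G F i) (tail i n `&` ball z r) (c' * dim_tilde G F i r).
  have [c1 c10 Ac1] := content_ge_large M0 (@YM i) (@Ycompact i) (fdim i) (gdim i)
    (@gdoubling i) (@f_preceq_g i) (Yregular i) (diam0 i) (Elarge i).
  apply: (content_ge_cylinder gG Ycompact (fun j => (cP j).1) (fun j => (cP j).2) (gF i) c10).
  move=> x r r0; apply: content_ge_subset (Ac1 x r r0) => y [Ay xy]; split=> //.
  exact: Ay.
have tpos i r : 0 < r -> 0 < dim_tilde g f i r.
  by move=> r0; rewrite /dim_tilde mulr_gt0 ?fpos// prodr_gt0// => j _; exact: gpos.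
(* The cylinder over coordinate [i] is large for the product function of [i]; the comparison brings
   all these bounds to the single function of [k]. *)
have cylk i n : J i -> exists2 c', 0 < c' & forall (z : Z) r, 0 < r ->
    content_ge (dim_tilde G F k) (tail i n `&` ball z r) (c' * dim_tilde G F k r).
  move=> Ji; have [c1 c10 c1P] := cyl i n.
  have [ik|ki] := Jk i Ji; first by rewrite -ik; exists c1.
  have [q q0 qP] := dim_preceq_quasi M0 (tpos k) (tpos i) ki.
  exists (Num.min 1 (q * c1)); first by rewrite lt_min ltr01 mulr_gt0.
  by move=> z r r0; apply: (content_ge_quasi (gT i)) => //; exact: c1P.
(* Any one cylinder bounds the content of full balls from below; this is the use of the element [j0]
   of [J]. *)
have [c0 c00 c0P] := cylk j0 0%N Jj0.
have ballP (z : Z) r : 0 < r -> content_ge (dim_tilde G F k) (ball z r) (c0 * dim_tilde G F k r).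
  by move=> r0; apply: content_ge_subset (c0P z r r0) => y [].
have [n|c' c'0 c'P] := content_ge_intersection cZ (gT k) c00 ballP oU.
  rewrite /U; case: choice.unpickle => [[i m]|]; rewrite ?/V /=; [case: ifP => Ji|].
  - exact: cylk.
  - by exists c0 => // z r r0; rewrite setTI; exact: ballP.
  - by exists c0 => // z r r0; rewrite setTI; exact: ballP.
apply: (large_of_content_ge M0 ZM (gT k) _ GA c'0).
  exact: (vanishing_tilde gG (gF k) (trunc_vanishing M0 (fdim k))).
by rewrite AE.
Qed.

End ProductTheorem.

Theorem theorem2p20 (R : realType) (d : nat) (Y : 'I_d -> metricType R)
    (g f : 'I_d -> R -> R) (E : forall i : 'I_d, nat -> set (Y i))
  (Ycompact : forall i, compact [set: Y i])
  (gdim : forall i, dimension_function (g i))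
  (gdoubling : forall i, doubling (g i))
  (Yregular : forall i, @ahlfors_regular R (Y i) (g i))
  (fdim : forall i, dimension_function (f i))
  (f_preceq_g : forall i, dim_preceq (f i) (g i))
  (fg_comparable : forall i j, i != j ->
     dim_preceq (fun r => f i r * g j r) (fun r => f j r * g i r) \/
     dim_preceq (fun r => f j r * g i r) (fun r => f i r * g j r))
  (Eopen : forall i n, open (E i n))
  (Elarge : forall i,
     large_intersection_class (f i) (lim_sup_set (E i))) :
  (forall i, large_intersection_class (dim_tilde g f i)
     [set x : max_product Y | lim_sup_set (E i) (x i)]) /\
  (forall k, (forall i, dim_preceq (dim_tilde g f k) (dim_tilde g f i)) ->
     large_intersection_class (dim_tilde g f k)
       [set x : max_product Y | forall i, lim_sup_set (E i) (x i)]).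
Proof.
split=> [i|k kmin].
  rewrite (_ : [set x : max_product Y | lim_sup_set (E i) (x i)] =
    [set x | forall j, j == i -> lim_sup_set (E j) (x j)]).
    by apply: (@large_limsup_product _ _ _ g f E _ _ _ _ _ _ _ _ i (pred1 i) i) => //= j /eqP;
      left.
  by apply/seteqP; split=> x /= xi; [move=> j /eqP->|exact: xi].
rewrite (_ : [set x : max_product Y | _] =
  [set x | forall j, predT j -> lim_sup_set (E j) (x j)]).
  by apply: (@large_limsup_product _ _ _ g f E _ _ _ _ _ _ _ _ k predT k) => // j _; right.
by apply/seteqP; split=> x /= xi j; [move=> _|]; exact: xi.
Qed.
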